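(* Let $q\in\mathbb{C}^*$ be not a root of unity, let $c\in\mathbb{C}$, and let $U_c=U_q(\mathfrak{sl}_2)/(Z_q-c)U_q(\mathfrak{sl}_2)$. Let $V$ be a simple (left) module over $U_c$. Then one of the following holds: (i) $V$ is a lowest weight module; (ii) $V$ is a highest weight module; (iii) $V$ is a simple module of intermediate series; (iv) There exists an $\alpha\in R_c$ such that $\alpha$ is irreducible in $B$ and $V\cong (R_c+B\alpha)/B\alpha$.
   Context: $U_q(\mathfrak{sl}_2)$ is the unital $\mathbb{C}$-algebra generated by $E,F,K,K^{-1}$ with relations $KK^{-1}=K^{-1}K=1$, $KEK^{-1}=q^2E$, $KFK^{-1}=q^{-2}F$, $[E,F]=\frac{K-K^{-1}}{q-q^{-1}}$. Its center is $\mathbb{C}[Z_q]$ with $Z_q=EF+\frac{1}{(q-q^{-1})^2}(q^{-1}K+qK^{-1})$. Let $\nu=q^2$ and let $R=\mathbb{C}_\nu[x^{\pm1},y^{\pm1}]$ be the quantum torus: the unital $\mathbb{C}$-algebra generated by $x^{\pm1},y^{\pm1}$ with $\nu xy=yx$. There is an injective algebra homomorphism $\phi:U_c\to R$ with $F\mapsto y$, $K^{\pm1}\mapsto x^{\pm1}$, $E\mapsto c\,y^{-1}-\frac{1}{(q-q^{-1})^2}(q^{-1}x+qx^{-1})y^{-1}$; put $R_c=\phi(U_c)$. Let $S=\mathbb{C}[x,x^{-1}]\setminus\{0\}$ and $B=S^{-1}R=\mathbb{C}(x)[y,y^{-1}]$, the skew Laurent polynomial ring with $yf(x)=f(\nu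 x)y$ for $f\in\mathbb{C}(x)$. The left $R_c$-module $(R_c+B\alpha)/B\alpha\subset B/B\alpha$ is regarded as a $U_c$-module via $\phi$. A highest (resp. lowest) weight module is a module generated by a nonzero vector $v$ with $Kv=\lambda v$ for some $\lambda\in\mathbb{C}^*$ and $Ev=0$ (resp. $Fv=0$). A simple module of intermediate series is a simple module having a basis $\{v_i\}_{i\in\mathbb{Z}}$ such that, for some $\lambda\in\mathbb{C}^*$ and all $i$, $Kv_i=\lambda q^{2i}v_i$, $Ev_i\in\mathbb{C}^*v_{i+1}$ and $Fv_i\in\mathbb{C}^*v_{i-1}$. *)

(* Defs.v *)
From HB Require Import structures.
From mathcomp Require Import all_boot all_order all_algebra.
From mathcomp Require Import fraction ring_quotient generic_quotient.
From mathcomp Require Import finmap boolp reals.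
From mathcomp Require Import complex.
From mathcomp Require Import ring.
From mathcomp Require Import monalg.

Set Implicit Arguments.
Unset Strict Implicit.
Unset Printing Implicit Defensive.

Import GRing.Theory.

Local Open Scope ring_scope.
Local Open Scope quotient_scope.

Local Notation "x %:F" := (@FracField.tofrac _ x).

Section LmodQuotient.
Variables (R : pzRingType) (V : lmodType R) (S : submodClosed V).

(* submodClosed does not inherit from zmodClosed, which Quotient.quot expects *)
Definition lquot_ideal : {pred V} := fun v => v \in S.
Fact lquot_ideal_zmod : zmod_closed lquot_ideal.
Proof.
split=> [|u v uS vS]; first exact: rpred0.
by rewrite unfold_in rpredD // -scaleN1r rpredZ.
Qed.
HB.instance Definition _ := GRing.isZmodClosed.Build V lquot_ideal
  lquot_ideal_zmod.

Definition lquot := Quotient.quot lquot_ideal.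
HB.instance Definition _ := GRing.Zmodule.on lquot.

Definition lproj (v : V) : lquot := \pi v.

Lemma lproj_eq u v : (lproj u = lproj v) <-> (u - v \in S).
Proof.
rewrite -[X in is_true X]/(u - v \in lquot_ideal) Quotient.idealrBE.
by split=> [|/eqP]; rewrite /lproj => ->.
Qed.

Lemma lproj_repr (z : lquot) : lproj (repr z) = z.
Proof. exact: reprK. Qed.

Lemma lproj_zmod : zmod_morphism lproj.
Proof. by move=> u v; rewrite /lproj -raddfB. Qed.
HB.instance Definition _ := GRing.isZmodMorphism.Build V lquot lproj lproj_zmod.

End LmodQuotient.

HB.lock Definition lquot_scale (R : pzRingType) (V : lmodType R)
  (S : submodClosed V) (a : R) (z : lquot S) : lquot S := lproj S (a *: repr z).

Section LmodQuotientTheory.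
Variables (R : pzRingType) (V : lmodType R) (S : submodClosed V).
Local Notation lquot := (lquot S).
Local Notation lproj := (lproj S).
Local Notation lquot_scale := (@lquot_scale R V S).

Lemma lquot_scaleE a v : lquot_scale a (lproj v) = lproj (a *: v).
Proof.
rewrite lquot_scale.unlock; apply/lproj_eq; rewrite -scalerBr rpredZ //.
by apply/lproj_eq; rewrite lproj_repr.
Qed.

Lemma lquot_scaleA a b z :
  lquot_scale a (lquot_scale b z) = lquot_scale (a * b) z.
Proof. by rewrite -[z]lproj_repr !lquot_scaleE scalerA. Qed.
Lemma lquot_scale1 : left_id 1 lquot_scale.
Proof. by move=> z; rewrite -[z]lproj_repr lquot_scaleE scale1r. Qed.
Lemma lquot_scaleDr : right_distributive lquot_scale +%R.
Proof.
move=> a y z; rewrite -[y]lproj_repr -[z]lproj_repr -raddfD !lquot_scaleE.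
by rewrite -raddfD -scalerDr.
Qed.
Lemma lquot_scaleDl z : {morph lquot_scale^~ z : a b / a + b}.
Proof.
by move=> a b; rewrite /= -[z]lproj_repr !lquot_scaleE -raddfD -scalerDl.
Qed.
HB.instance Definition _ := GRing.Zmodule_isLmodule.Build R lquot
  lquot_scaleA lquot_scale1 lquot_scaleDr lquot_scaleDl.

Lemma lproj_scalable : scalable lproj.
Proof. by move=> a v; rewrite -lquot_scaleE. Qed.
HB.instance Definition _ := GRing.isScalable.Build R V lquot *:%R lproj
  lproj_scalable.

End LmodQuotientTheory.

Definition two_sided_ideal (A : pzRingType) (I : {pred A}) : Prop :=
  zmod_closed I /\
  (forall a u, u \in I -> (a * u \in I) /\ (u * a \in I)).

Section GenIdeal.
Variables (k : pzRingType) (A : algType k) (X : seq A).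

Definition gen_ideal : {pred A} := fun u =>
  `[< forall I : {pred A}, two_sided_ideal I -> {subset X <= I} -> u \in I >].

Lemma gen_idealP u :
  reflect (forall I : {pred A}, two_sided_ideal I -> {subset X <= I} -> u \in I)
          (u \in gen_ideal).
Proof. exact: asboolP. Qed.

Lemma gen_ideal_sub : {subset X <= gen_ideal}.
Proof. by move=> u uX; apply/gen_idealP => I _; apply. Qed.

Lemma gen_ideal_ideal : two_sided_ideal gen_ideal.
Proof.
split; first split.
- by apply/gen_idealP => I [[]].
- move=> u v /gen_idealP uX /gen_idealP vX; apply/gen_idealP => I idI XI.
  by case: (idI) => -[_ subI] _; apply: subI; [apply: uX|apply: vX].
- move=> a u /gen_idealP uX; split; apply/gen_idealP => I idI XI.
  + by case: (idI) => _ /(_ a _ (uX I idI XI))[].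
  + by case: (idI) => _ /(_ a _ (uX I idI XI))[].
Qed.

Fact gen_ideal_submod : submod_closed gen_ideal.
Proof.
case: gen_ideal_ideal => -[I0 IB] IM; split=> // a u v uI vI.
rewrite -[v]opprK IB //; first by rewrite -[u]mul1r scalerAl (IM _ _ uI).1.
by rewrite -sub0r IB.
Qed.
HB.instance Definition _ := GRing.isSubmodClosed.Build k A gen_ideal
  gen_ideal_submod.

Lemma gen_ideal_ker (S : pzRingType) (f : {rmorphism A -> S}) :
  {in X, forall u, f u = 0} -> {in gen_ideal, forall u, f u = 0}.
Proof.
move=> fX u /gen_idealP/(_ (fun w => f w == 0)) fu; apply/eqP; apply: fu.
  split; first split; rewrite ?unfold_in ?rmorph0 //.
    by move=> v w; rewrite !unfold_in rmorphB => /eqP-> /eqP->; rewrite subrr.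
  by move=> a w; rewrite !unfold_in !rmorphM => /eqP->; rewrite mulr0 mul0r.
by move=> w wX; rewrite unfold_in fX.
Qed.

Lemma gen_ideal_proper (S : nzRingType) (f : {rmorphism A -> S}) :
  {in X, forall u, f u = 0} -> 1 \notin gen_ideal.
Proof.
move=> fX; apply/negP => /(gen_ideal_ker fX)/eqP.
by rewrite rmorph1 oner_eq0.
Qed.

End GenIdeal.

Section AlgQuotient.
Variables (k : pzRingType) (A : algType k) (X : seq A).
Hypothesis X1 : 1 \notin gen_ideal X.
Local Notation gen_ideal := (gen_ideal X).

Definition quot_alg of 1 \notin gen_ideal := lquot gen_ideal.
Local Notation Q := (quot_alg X1).
HB.instance Definition _ := GRing.Lmodule.on Q.

End AlgQuotient.

HB.lock Definition qproj (k : pzRingType) (A : algType k) (X : seq A)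
  (X1 : 1 \notin gen_ideal X) (u : A) : quot_alg X1 := lproj (gen_ideal X) u.

Section AlgQuotientRing.
Variables (k : pzRingType) (A : algType k) (X : seq A).
Hypothesis X1 : 1 \notin gen_ideal X.
Local Notation gen_ideal := (gen_ideal X).
Local Notation Q := (quot_alg X1).
Local Notation qproj := (@qproj k A X X1).

Fact qproj_linear : linear qproj.
Proof. by move=> a u v; rewrite qproj.unlock linearP. Qed.
HB.instance Definition _ := GRing.isLinear.Build k A Q *:%R qproj
  qproj_linear.

Lemma qproj_eq u v : (qproj u = qproj v) <-> (u - v \in gen_ideal).
Proof. by rewrite qproj.unlock; exact: lproj_eq. Qed.

Lemma qproj_repr (z : Q) : qproj (repr z) = z.
Proof. by rewrite qproj.unlock; exact: lproj_repr. Qed.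

End AlgQuotientRing.

HB.lock Definition quot_mul (k : pzRingType) (A : algType k) (X : seq A)
    (X1 : 1 \notin gen_ideal X) (y z : quot_alg X1) : quot_alg X1 :=
  qproj X1 (repr y * repr z).

Section AlgQuotientTheory.
Variables (k : pzRingType) (A : algType k) (X : seq A).
Hypothesis X1 : 1 \notin gen_ideal X.
Local Notation gen_ideal := (gen_ideal X).
Local Notation Q := (quot_alg X1).
Local Notation qproj := (@qproj k A X X1).
Local Notation quot_mul := (@quot_mul k A X X1).

Lemma quot_mulE u v : quot_mul (qproj u) (qproj v) = qproj (u * v).
Proof.
have [_ IM] := gen_ideal_ideal X; rewrite quot_mul.unlock.
set u' := repr (qproj u); set v' := repr (qproj v).
have uu' : u' - u \in gen_ideal by apply/qproj_eq; rewrite qproj_repr.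
have vv' : v' - v \in gen_ideal by apply/qproj_eq; rewrite qproj_repr.
apply/qproj_eq; have -> : u' * v' - u * v = (u' - u) * v' + u * (v' - v).
  by rewrite mulrBl mulrBr addrA subrK.
by rewrite rpredD ?(IM _ _ uu').2 ?(IM _ _ vv').1.
Qed.

Lemma quot_mulA : associative quot_mul.
Proof.
move=> x y z; rewrite -[x]qproj_repr -[y]qproj_repr -[z]qproj_repr.
by rewrite !quot_mulE mulrA.
Qed.
Lemma quot_mul1r : left_id (qproj 1) quot_mul.
Proof. by move=> x; rewrite -[x]qproj_repr quot_mulE mul1r. Qed.
Lemma quot_mulr1 : right_id (qproj 1) quot_mul.
Proof. by move=> x; rewrite -[x]qproj_repr quot_mulE mulr1. Qed.
Lemma quot_mulDl : left_distributive quot_mul +%R.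
Proof.
move=> x y z; rewrite -[x]qproj_repr -[y]qproj_repr -[z]qproj_repr.
by rewrite -raddfD !quot_mulE -raddfD mulrDl.
Qed.
Lemma quot_mulDr : right_distributive quot_mul +%R.
Proof.
move=> x y z; rewrite -[x]qproj_repr -[y]qproj_repr -[z]qproj_repr.
by rewrite -raddfD !quot_mulE -raddfD mulrDr.
Qed.
Lemma quot_oner_neq0 : qproj 1 != 0.
Proof.
apply: contra X1 => /eqP; rewrite -(raddf0 qproj) => /qproj_eq.
by rewrite subr0.
Qed.
HB.instance Definition _ := GRing.Zmodule_isNzRing.Build Q
  quot_mulA quot_mul1r quot_mulr1 quot_mulDl quot_mulDr quot_oner_neq0.

Lemma qproj_monoid : monoid_morphism qproj.
Proof. by split=> // u v; rewrite -quot_mulE. Qed.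
HB.instance Definition _ := GRing.isMonoidMorphism.Build A Q qproj
  qproj_monoid.

Lemma quot_scalerAl (a : k) (y z : Q) : a *: (y * z) = (a *: y) * z.
Proof.
rewrite -[y]qproj_repr -[z]qproj_repr -rmorphM -!linearZ /=.
by rewrite -rmorphM scalerAl.
Qed.
HB.instance Definition _ := GRing.Lmodule_isLalgebra.Build k Q
  quot_scalerAl.
Lemma quot_scalerAr (a : k) (y z : Q) : a *: (y * z) = y * (a *: z).
Proof.
rewrite -[y]qproj_repr -[z]qproj_repr -rmorphM -!linearZ /=.
by rewrite -rmorphM scalerAr.
Qed.
HB.instance Definition _ := GRing.Lalgebra_isAlgebra.Build k Q
  quot_scalerAr.

End AlgQuotientTheory.

HB.lock Definition quot_lift (k : pzRingType) (A : algType k) (X : seq A)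
    (X1 : 1 \notin gen_ideal X) (S : algType k) (f : {lrmorphism A -> S})
    (fX : {in X, forall u, f u = 0}) (z : quot_alg X1) : S := f (repr z).
Arguments quot_lift {k A X} X1 {S f} fX z.

Section QuotLift.
Variables (k : pzRingType) (A : algType k) (X : seq A).
Hypothesis X1 : 1 \notin gen_ideal X.
Local Notation Q := (quot_alg X1).
Local Notation qproj := (@qproj k A X X1).
Variables (S : algType k) (f : {lrmorphism A -> S}).
Hypothesis fX : {in X, forall u, f u = 0}.
Local Notation lift := (quot_lift X1 fX).

Lemma quot_liftE u : lift (qproj u) = f u.
Proof.
rewrite quot_lift.unlock.
apply/eqP; rewrite -subr_eq0 -rmorphB; apply/eqP; apply: (gen_ideal_ker fX).
by apply/(qproj_eq X1); rewrite qproj_repr.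
Qed.

Lemma quot_lift_zmod : zmod_morphism lift.
Proof.
move=> y z; rewrite -[y]qproj_repr -[z]qproj_repr -raddfB !quot_liftE.
exact: rmorphB.
Qed.
Lemma quot_lift_monoid : monoid_morphism lift.
Proof.
split=> [|y z]; first by rewrite -(rmorph1 qproj) quot_liftE rmorph1.
by rewrite -[y]qproj_repr -[z]qproj_repr -rmorphM !quot_liftE rmorphM.
Qed.
Lemma quot_lift_scalable : scalable lift.
Proof.
by move=> a y; rewrite -[y]qproj_repr -linearZ !quot_liftE linearZ.
Qed.
HB.instance Definition _ := GRing.isZmodMorphism.Build Q S lift
  quot_lift_zmod.
HB.instance Definition _ := GRing.isMonoidMorphism.Build Q S lift
  quot_lift_monoid.
HB.instance Definition _ := GRing.isScalable.Build k Q S *:%R lift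
  quot_lift_scalable.
End QuotLift.

Section FreeAlgebra.
Variables (k : comNzRingType) (I : choiceType).

Definition free_alg := {malg k[{fmonom I}]}.
HB.instance Definition _ := GRing.Lalgebra.on free_alg.

Lemma free_alg_scalerAr (a : k) (u v : free_alg) : a *: (u * v) = u * (a *: v).
Proof.
apply/malgP => m; rewrite mcoeffZ (mcoeffMlw _ (fsubset_refl _) (msuppZ_le _ _)).
rewrite mcoeffMl mulr_sumr; apply: eq_bigr => i _; rewrite mulr_sumr.
by apply: eq_bigr => j _; rewrite mcoeffZ mulrCA mulrnAr.
Qed.
HB.instance Definition _ := GRing.Lalgebra_isAlgebra.Build k free_alg
  free_alg_scalerAr.

End FreeAlgebra.

HB.lock Definition fgen (k : comNzRingType) (I : choiceType) (i : I) :
  free_alg k I := mkmalgU (fmu i) 1.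

Section FreeAlgebraTheory.
Variables (k : comNzRingType) (I : choiceType).
Local Notation free_alg := (free_alg k I).
Local Notation fgen := (@fgen k I).

Lemma fgen_prod (m : {fmonom I}) :
  \prod_(i <- (m : seq I)) fgen i = mkmalgU m 1 :> free_alg.
Proof.
rewrite -[m in RHS]fmK; elim: (fmonom_val m) => [|i s IH].
  by rewrite big_nil -fmoneE.
have -> : FMonom (i :: s) = fmmul (fmu i) (FMonom s) by rewrite fmmulE fmuE.
by rewrite big_cons IH fgen.unlock [LHS]fgmulUU mul1r.
Qed.

Lemma free_algE (u : free_alg) :
  u = \sum_(m <- msupp u) u@_m *: \prod_(i <- (m : seq I)) fgen i.
Proof.
rewrite [LHS]monalgE; apply: eq_bigr => m _; apply/malgP => n.
by rewrite fgen_prod mcoeffZ !mcoeffU mulrnAr mulr1.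
Qed.

Variables (S : algType k) (g : I -> S).

Definition free_word (m : {fmonom I}) : S := \prod_(i <- (m : seq I)) g i.

Lemma free_word_morph : mmorphism free_word.
Proof.
split=> [m n|]; first by rewrite /free_word fmM big_cat.
by rewrite /free_word fm1 big_nil.
Qed.
HB.instance Definition _ := monalg.isMultiplicative.Build {fmonom I} S free_word
  free_word_morph.

Definition free_eval : free_alg -> S := mmap (GRing.in_alg S) free_word.

Lemma free_eval_zmod : zmod_morphism free_eval.
Proof. exact: raddfB. Qed.
Lemma free_eval_monoid : monoid_morphism free_eval.
Proof.
have [fM f1] : multiplicative free_eval.
  apply: commr_mmap_is_multiplicative => u m n.
  by rewrite /GRing.comm /= -!scalerAl -scalerAr mul1r mulr1.
by split.
Qed.
Lemma free_eval_scalable : scalable free_eval.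
Proof. by move=> a u; rewrite /free_eval mmapZ mulr_algl. Qed.
HB.instance Definition _ := GRing.isZmodMorphism.Build free_alg S free_eval
  free_eval_zmod.
HB.instance Definition _ := GRing.isMonoidMorphism.Build free_alg S free_eval
  free_eval_monoid.
HB.instance Definition _ := GRing.isScalable.Build k free_alg S *:%R free_eval
  free_eval_scalable.

Lemma free_eval_gen i : free_eval (fgen i) = g i.
Proof. by rewrite fgen.unlock /free_eval mmapU /= scale1r mul1r /free_word fmU big_seq1. Qed.

End FreeAlgebraTheory.

Section FracLift.
Variables (R : idomainType) (L : fieldType) (f : {rmorphism R -> L}).
Hypothesis f_inj : injective f.

Definition frac_lift of injective f :=
  fun z : {fraction R} => f \n_(repr z) / f \d_(repr z).
Local Notation lift := (frac_lift f_inj).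

Lemma fracE (z : {fraction R}) :
  z = (\n_(repr z))%:F / (\d_(repr z))%:F.
Proof.
apply: (mulIf (x := (\d_(repr z))%:F)); first by rewrite tofrac_eq0 denom_ratioP.
rewrite mulfVK ?tofrac_eq0 ?denom_ratioP // -{1}[z]reprK.
rewrite -[LHS]/(FracField.mul _ _) /FracField.tofrac; unlock; rewrite !piE.
apply/eqP; rewrite piE FracField.equivfE /FracField.mulf.
by rewrite !numden_Ratio ?mulf_neq0 ?denom_ratioP ?oner_neq0 // !mulr1 mulrC.
Qed.

Let f_neq0 a : a != 0 -> f a != 0.
Proof. by move=> a0; rewrite -(rmorph0 f) (inj_eq f_inj). Qed.

Lemma frac_lift_div a b : b != 0 -> lift (a%:F / b%:F) = f a / f b.
Proof.
move=> b0; rewrite /frac_lift; set z : {fraction R} := a%:F / b%:F.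
have d0 : \d_(repr z) != 0 by exact: denom_ratioP.
apply/eqP; rewrite eqr_div ?f_neq0 // -!rmorphM (inj_eq f_inj).
rewrite -tofrac_eq !rmorphM /= -eqr_div ?tofrac_eq0 //.
by rewrite -fracE.
Qed.

Lemma frac_lift_tofrac a : lift a%:F = f a.
Proof.
have := frac_lift_div a (oner_neq0 R).
by rewrite !rmorph1 !divr1.
Qed.

Lemma frac_lift_zmod : zmod_morphism lift.
Proof.
move=> y z; rewrite [y]fracE [z]fracE.
set a := \n_(repr y); set b := \d_(repr y).
set c := \n_(repr z); set d := \d_(repr z).
have b0 : b != 0 by exact: denom_ratioP.
have d0 : d != 0 by exact: denom_ratioP.
rewrite -mulNr addf_div ?tofrac_eq0 // !frac_lift_div //.
rewrite -rmorphN -!rmorphM -rmorphD frac_lift_div ?mulf_neq0 //.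
by rewrite rmorphD !rmorphM rmorphN -addf_div ?f_neq0 // mulNr.
Qed.

Lemma frac_lift_monoid : monoid_morphism lift.
Proof.
split=> [|y z]; first by rewrite -(rmorph1 (@FracField.tofrac R)) frac_lift_tofrac rmorph1.
rewrite [y]fracE [z]fracE.
set a := \n_(repr y); set b := \d_(repr y).
set c := \n_(repr z); set d := \d_(repr z).
have b0 : b != 0 by exact: denom_ratioP.
have d0 : d != 0 by exact: denom_ratioP.
rewrite mulf_div !frac_lift_div // -!rmorphM frac_lift_div ?mulf_neq0 //.
by rewrite !rmorphM -mulf_div.
Qed.
HB.instance Definition _ := GRing.isZmodMorphism.Build {fraction R} L lift
  frac_lift_zmod.
HB.instance Definition _ := GRing.isMonoidMorphism.Build {fraction R} L
  lift frac_lift_monoid.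
End FracLift.

Record ring_aut (K : nzRingType) := RingAut {
  aut_fun :> {rmorphism K -> K};
  aut_inv : {rmorphism K -> K};
  aut_funK : cancel aut_fun aut_inv;
  aut_invK : cancel aut_inv aut_fun
}.

Section Dilation.
Variables (k : fieldType).

Definition dil_poly (a : k) (p : {poly k}) : {poly k} := p \Po (a *: 'X).
Fact dil_poly_zmod a : zmod_morphism (dil_poly a).
Proof. exact: raddfB. Qed.
Fact dil_poly_monoid a : monoid_morphism (dil_poly a).
Proof. by split; [exact: rmorph1|exact: rmorphM]. Qed.
HB.instance Definition _ a := GRing.isZmodMorphism.Build {poly k} {poly k}
  (dil_poly a) (dil_poly_zmod a).
HB.instance Definition _ a := GRing.isMonoidMorphism.Build {poly k} {poly k}
  (dil_poly a) (dil_poly_monoid a).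

Lemma dil_polyK (a : k) : a != 0 -> cancel (dil_poly a) (dil_poly a^-1).
Proof.
move=> a0 p; rewrite /dil_poly -comp_polyA comp_polyZ comp_polyX.
by rewrite scalerA mulfV // scale1r comp_polyXr.
Qed.

Definition dil_frac (a : k) : {rmorphism {poly k} -> {fraction {poly k}}} :=
  @FracField.tofrac {poly k} \o dil_poly a.

Lemma dil_frac_inj (a : k) : a != 0 -> injective (dil_frac a).
Proof.
move=> a0 p r /eqP /=; rewrite tofrac_eq => /eqP.
exact: (can_inj (dil_polyK a0)).
Qed.

(* f(x) |-> f(a x) on k(x) *)
Definition dilation (a : k) (a0 : a != 0) :
    {rmorphism {fraction {poly k}} -> {fraction {poly k}}} :=
  frac_lift (dil_frac_inj a0).

Lemma dilation_tofrac a (a0 : a != 0) p : dilation a0 p%:F = (dil_poly a p)%:F.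
Proof. exact: frac_lift_tofrac. Qed.

Lemma dilation_div a (a0 : a != 0) p r :
  dilation a0 (p%:F / r%:F) = (dil_poly a p)%:F / (dil_poly a r)%:F.
Proof. by rewrite (fmorph_div (dilation a0)) !dilation_tofrac. Qed.

Lemma dilationK a b (a0 : a != 0) (b0 : b != 0) :
  a * b = 1 -> cancel (dilation a0) (dilation b0).
Proof.
move=> ab1 z; have ab : b = a^-1 by apply: (mulfI a0); rewrite ab1 mulfV.
have abK p : dil_poly b (dil_poly a p) = p by rewrite ab dil_polyK.
rewrite [z]fracE; move: \n_(repr z) \d_(repr z) => p r.
by rewrite !dilation_div !abK.
Qed.

Definition dilation_aut (a : k) (a0 : a != 0) : ring_aut {fraction {poly k}} :=
  RingAut (@dilationK a a^-1 a0 (invr_neq0 a0) (mulfV a0))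
          (@dilationK a^-1 a (invr_neq0 a0) a0 (mulVf a0)).

End Dilation.

Section AutExp.
Variables (K : nzRingType) (s : ring_aut K).

Definition aut_exp (m : int) : K -> K :=
  match m with Posz n => iter n s | Negz n => iter n.+1 (aut_inv s) end.

Lemma aut_expS m a : aut_exp (m + 1) a = s (aut_exp m a).
Proof.
case: m => [n|[|n]]; first by rewrite -PoszD addn1.
  by rewrite /= aut_invK.
have -> : Negz n.+1 + 1 = Negz n by rewrite !NegzE -[in LHS]addn1 PoszD opprD addrK.
by rewrite /= aut_invK.
Qed.

Lemma aut_expB m a : aut_exp (m - 1) a = aut_inv s (aut_exp m a).
Proof. by rewrite -[m in RHS](subrK 1) aut_expS aut_funK. Qed.

Lemma aut_expD m n a : aut_exp (m + n) a = aut_exp m (aut_exp n a).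
Proof.
elim/int_rect: m => [|m IH|m IH]; first by rewrite add0r.
  by rewrite -addn1 PoszD addrAC !aut_expS IH.
by rewrite -addn1 PoszD opprD addrAC !aut_expB IH.
Qed.

Lemma iter_zmod (f : {rmorphism K -> K}) n : zmod_morphism (iter n f).
Proof. by elim: n => // n IH a b; rewrite /= IH rmorphB. Qed.
Lemma iter_monoid (f : {rmorphism K -> K}) n : monoid_morphism (iter n f).
Proof.
by elim: n => // n [IH1 IHM]; split=> [|a b]; rewrite /= ?IH1 ?IHM (rmorph1, rmorphM).
Qed.

Lemma aut_exp_zmod m : zmod_morphism (aut_exp m).
Proof. by case: m => n; exact: iter_zmod. Qed.
Lemma aut_exp_monoid m : monoid_morphism (aut_exp m).
Proof. by case: m => n; exact: iter_monoid. Qed.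
HB.instance Definition _ m := GRing.isZmodMorphism.Build K K (aut_exp m)
  (aut_exp_zmod m).
HB.instance Definition _ m := GRing.isMonoidMorphism.Build K K (aut_exp m)
  (aut_exp_monoid m).
End AutExp.

Section SkewLaurent.
Variables (K : nzRingType) (s : ring_aut K).

(* The finitely supported function a : int -> K stands for
   \sum_n a@_n y^n, with multiplication determined by y f = s(f) y. *)
Definition skew_laurent of ring_aut K := {malg K[int]}.
Local Notation B := (skew_laurent s).
HB.instance Definition _ := GRing.Zmodule.on B.

Definition sl_term (a : K) (n : int) : B := mkmalgU n a.

End SkewLaurent.

HB.lock Definition sl_mul (K : nzRingType) (s : ring_aut K)
    (u v : skew_laurent s) : skew_laurent s :=
  \sum_(i <- msupp u) \sum_(j <- msupp v)
    sl_term s (u@_i * aut_exp s i v@_j) (i + j).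

Section SkewLaurentTheory.
Variables (K : nzRingType) (s : ring_aut K).
Local Notation B := (skew_laurent s).
Local Notation sl_term := (@sl_term K s).
Local Notation sl_mul := (@sl_mul K s).

Lemma sl_term0 n : sl_term 0 n = 0.
Proof. exact: monalgU0. Qed.
Lemma sl_termD a b n : sl_term (a + b) n = sl_term a n + sl_term b n.
Proof. exact: monalgUD. Qed.

Lemma sl_mulE (d1 d2 : {fset int}) u v :
  (msupp u `<=` d1)%fset -> (msupp v `<=` d2)%fset ->
  sl_mul u v = \sum_(i <- d1) \sum_(j <- d2)
    sl_term (u@_i * aut_exp s i v@_j) (i + j).
Proof.
move=> le1 le2; rewrite sl_mul.unlock (big_fset_incl _ le1) /=.
  apply/eq_bigr=> i _; apply/big_fset_incl => // j _ /mcoeff_outdom ->.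
  by rewrite raddf0 mulr0 sl_term0.
move=> i _ /mcoeff_outdom ui; rewrite big1 // => j _.
by rewrite ui mul0r sl_term0.
Qed.

Lemma sl_mulDl : left_distributive sl_mul +%R.
Proof.
move=> u v w; rewrite [in RHS](sl_mulE (fsubsetUl _ (msupp v)) (fsubset_refl _)).
rewrite [sl_mul v w](sl_mulE (fsubsetUr (msupp u) _) (fsubset_refl _)).
rewrite (sl_mulE (msuppD_le _ _) (fsubset_refl _)) -big_split /=.
apply/eq_bigr=> i _; rewrite -big_split /=; apply/eq_bigr=> j _.
by rewrite mcoeffD mulrDl sl_termD.
Qed.

Lemma sl_mulDr : right_distributive sl_mul +%R.
Proof.
move=> w u v; rewrite [sl_mul w u](sl_mulE (fsubset_refl _) (fsubsetUl _ (msupp v))).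
rewrite [sl_mul w v](sl_mulE (fsubset_refl _) (fsubsetUr (msupp u) _)).
rewrite (sl_mulE (fsubset_refl _) (msuppD_le _ _)) -big_split /=.
apply/eq_bigr=> i _; rewrite -big_split /=; apply/eq_bigr=> j _.
by rewrite mcoeffD raddfD mulrDr sl_termD.
Qed.

Lemma sl_mul0l u : sl_mul 0 u = 0.
Proof. by rewrite sl_mul.unlock msupp0 big_seq_fset0. Qed.
Lemma sl_mul0r u : sl_mul u 0 = 0.
Proof. by rewrite sl_mul.unlock big1 // => i _; rewrite msupp0 big_seq_fset0. Qed.

Lemma sl_mulUU a b m n :
  sl_mul (sl_term a m) (sl_term b n) = sl_term (a * aut_exp s m b) (m + n).
Proof. by rewrite (sl_mulE msuppU_le msuppU_le) !big_seq_fset1 !mcoeffUU. Qed.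

Lemma sl_sum u : u = \sum_(i <- msupp u) sl_term u@_i i.
Proof. exact: monalgE. Qed.

Lemma sl_mul_suml (I : Type) (r : seq I) (F : I -> B) v :
  sl_mul (\sum_(i <- r) F i) v = \sum_(i <- r) sl_mul (F i) v.
Proof. exact: (big_morph (sl_mul^~ v) (fun _ _ => sl_mulDl _ _ _) (sl_mul0l v)). Qed.
Lemma sl_mul_sumr (I : Type) (r : seq I) (F : I -> B) v :
  sl_mul v (\sum_(i <- r) F i) = \sum_(i <- r) sl_mul v (F i).
Proof. exact: (big_morph (sl_mul v) (fun _ _ => sl_mulDr _ _ _) (sl_mul0r v)). Qed.

Lemma sl_mulA : associative sl_mul.
Proof.
move=> u v w; rewrite [u]sl_sum !sl_mul_suml; apply: eq_bigr => i _.
rewrite [v]sl_sum !(sl_mul_suml, sl_mul_sumr); apply: eq_bigr => j _.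
rewrite [w]sl_sum !sl_mul_sumr; apply: eq_bigr => l _.
by rewrite !sl_mulUU rmorphM aut_expD addrA mulrA.
Qed.

Lemma sl_mul1l : left_id (sl_term 1 0) sl_mul.
Proof.
move=> u; rewrite [u]sl_sum sl_mul_sumr; apply: eq_bigr => i _.
by rewrite sl_mulUU mul1r add0r.
Qed.
Lemma sl_mul1r : right_id (sl_term 1 0) sl_mul.
Proof.
move=> u; rewrite [u]sl_sum sl_mul_suml; apply: eq_bigr => i _.
by rewrite sl_mulUU rmorph1 mulr1 addr0.
Qed.
Lemma sl_oner_neq0 : sl_term 1 0 != 0.
Proof. by rewrite monalgU_eq0 oner_eq0. Qed.

HB.instance Definition _ := GRing.Zmodule_isNzRing.Build B
  sl_mulA sl_mul1l sl_mul1r sl_mulDl sl_mulDr sl_oner_neq0.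

Lemma sl_termM a b m n :
  sl_term a m * sl_term b n = sl_term (a * aut_exp s m b) (m + n).
Proof. exact: sl_mulUU. Qed.

End SkewLaurentTheory.

Section LocTorus.
Variables (k : fieldType) (nu : k) (nu0 : nu != 0).

(* k(x)[y, y^-1] with y f(x) = f(nu x) y *)
Definition loc_torus := skew_laurent (dilation_aut nu0).
Local Notation B := loc_torus.
HB.instance Definition _ := GRing.NzRing.on B.

Definition lt_const (a : k) : B := sl_term (dilation_aut nu0) (a%:P)%:F 0.

Lemma lt_const_fix (a : k) n : aut_exp (dilation_aut nu0) n (a%:P)%:F = (a%:P)%:F.
Proof.
have fix1 (b : k) (b0 : b != 0) : dilation b0 (a%:P)%:F = (a%:P)%:F.
  by rewrite dilation_tofrac /dil_poly comp_polyC.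
by case: n => n; rewrite /aut_exp; [elim: n|elim: n.+1] => // {}n;
  rewrite iterS => ->; exact: fix1.
Qed.

Lemma lt_const_zmod : zmod_morphism lt_const.
Proof. by move=> a b; rewrite /lt_const !rmorphB [LHS]monalgUB. Qed.
Lemma lt_const_monoid : monoid_morphism lt_const.
Proof.
split=> [|a b]; first by rewrite /lt_const !rmorph1.
by rewrite /lt_const [RHS]sl_termM lt_const_fix addr0 !rmorphM.
Qed.
HB.instance Definition _ := GRing.isZmodMorphism.Build k B lt_const
  lt_const_zmod.
HB.instance Definition _ := GRing.isMonoidMorphism.Build k B lt_const
  lt_const_monoid.

Lemma lt_constC a (u : B) : lt_const a * u = u * lt_const a.
Proof.
rewrite [u](@sl_sum _ (dilation_aut nu0)) mulr_sumr mulr_suml.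
apply: eq_bigr => i _; rewrite /lt_const [LHS]sl_termM [RHS]sl_termM.
by rewrite lt_const_fix addr0 add0r mulrC.
Qed.

Definition lt_scale (a : k) (u : B) : B := lt_const a * u.
Lemma lt_scaleA a b u : lt_scale a (lt_scale b u) = lt_scale (a * b) u.
Proof. by rewrite /lt_scale rmorphM mulrA. Qed.
Lemma lt_scale1 : left_id 1 lt_scale.
Proof. by move=> u; rewrite /lt_scale rmorph1 mul1r. Qed.
Lemma lt_scaleDr : right_distributive lt_scale +%R.
Proof. by move=> a u v; rewrite /lt_scale mulrDr. Qed.
Lemma lt_scaleDl u : {morph lt_scale^~ u : a b / a + b}.
Proof. by move=> a b; rewrite /lt_scale rmorphD mulrDl. Qed.
HB.instance Definition _ := GRing.Zmodule_isLmodule.Build k B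
  lt_scaleA lt_scale1 lt_scaleDr lt_scaleDl.
Lemma lt_scalerAl (a : k) (u v : B) : a *: (u * v) = (a *: u) * v.
Proof. exact: mulrA. Qed.
HB.instance Definition _ := GRing.Lmodule_isLalgebra.Build k B lt_scalerAl.
Lemma lt_scalerAr (a : k) (u v : B) : a *: (u * v) = u * (a *: v).
Proof.
rewrite -[LHS]/(lt_const a * (u * v)) -[a *: v]/(lt_const a * v).
by rewrite !mulrA lt_constC.
Qed.
HB.instance Definition _ := GRing.Lalgebra_isAlgebra.Build k B lt_scalerAr.

Definition lt_x : B := sl_term (dilation_aut nu0) 'X%:F 0.
Definition lt_xi : B := sl_term (dilation_aut nu0) ('X%:F)^-1 0.
Definition lt_y : B := sl_term (dilation_aut nu0) 1 1.
Definition lt_yi : B := sl_term (dilation_aut nu0) 1 (-1).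

Lemma lt_y_comm (f : {fraction {poly k}}) :
  lt_y * sl_term (dilation_aut nu0) f 0
  = sl_term (dilation_aut nu0) (dilation nu0 f) 0 * lt_y.
Proof.
by rewrite [LHS]sl_termM [RHS]sl_termM mul1r rmorph1 mulr1 addr0 add0r.
Qed.

End LocTorus.

(* A trailing i marks an inverse generator: Ki = K^-1, xi = x^-1, yi = y^-1. A
   list of relations stands for the equations r = 0, r in the list. *)
Section Relations.
Variables (k : fieldType) (S : algType k).

Definition qt_rels (nu : k) (x xi y yi : S) : seq S :=
  [:: x * xi - 1; xi * x - 1; y * yi - 1; yi * y - 1; nu *: (x * y) - y * x].

Definition uq_rels (q : k) (e f K Ki : S) : seq S :=
  [:: K * Ki - 1; Ki * K - 1;
      K * e * Ki - q ^+ 2 *: e; K * f * Ki - q ^- 2 *: f;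
      e * f - f * e - (q - q^-1)^-1 *: (K - Ki)].

Definition casimir (q : k) (e f K Ki : S) : S :=
  e * f + (q - q^-1) ^- 2 *: (q^-1 *: K + q *: Ki).

(* the image of E in the quantum torus *)
Definition phi_E (q c : k) (x xi yi : S) : S :=
  c *: yi - (q - q^-1) ^- 2 *: (q^-1 *: x + q *: xi) * yi.

End Relations.

Section RelationsTheory.
Variables (k : fieldType) (S T : algType k) (h : {lrmorphism S -> T}).

Lemma qt_rels_map nu x xi y yi :
  map h (qt_rels nu x xi y yi) = qt_rels nu (h x) (h xi) (h y) (h yi).
Proof. by rewrite /= !rmorphB /= !linearZ /= !rmorphM !rmorph1. Qed.

Lemma uq_rels_map q e f K Ki :
  map h (uq_rels q e f K Ki) = uq_rels q (h e) (h f) (h K) (h Ki).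
Proof.
by rewrite /= !rmorphB /= !linearZ /= !rmorphB /= !rmorphM !rmorph1 !scalerN.
Qed.

Lemma casimir_map q e f K Ki :
  h (casimir q e f K Ki) = casimir q (h e) (h f) (h K) (h Ki).
Proof. by rewrite rmorphD rmorphM /= linearZ /= rmorphD /= !linearZ. Qed.

Variables (q c : k) (x xi y yi : S).
Hypothesis q0 : q != 0.
Hypothesis xyP : {in qt_rels (q ^+ 2) x xi y yi, forall u, u = 0}.

Let xxi : x * xi = 1.
Proof. by apply/subr0_eq/xyP; rewrite !inE eqxx. Qed.
Let xix : xi * x = 1.
Proof. by apply/subr0_eq/xyP; rewrite !inE eqxx ?orbT. Qed.
Let yyi : y * yi = 1.
Proof. by apply/subr0_eq/xyP; rewrite !inE eqxx ?orbT. Qed.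
Let yiy : yi * y = 1.
Proof. by apply/subr0_eq/xyP; rewrite !inE eqxx ?orbT. Qed.
Let yx : y * x = q ^+ 2 *: (x * y).
Proof. by apply/esym/subr0_eq/xyP; rewrite !inE eqxx ?orbT. Qed.
Let q20 : q ^+ 2 != 0. Proof. exact: expf_neq0. Qed.
Let yxi : y * xi = q ^- 2 *: (xi * y).
Proof.
rewrite -[LHS]mul1r -xix -mulrA [x * _]mulrA.
have -> : x * y = q ^- 2 *: (y * x) by rewrite yx scalerA mulVf ?scale1r.
by rewrite -scalerAl -scalerAr -mulrA xxi mulr1.
Qed.
Let xyi : x * yi = q ^+ 2 *: (yi * x).
Proof.
rewrite -[LHS]mul1r -yiy -mulrA [y * _]mulrA yx -!scalerAl -scalerAr.
by rewrite -[x * y * yi]mulrA yyi mulr1.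
Qed.

Lemma phi_E_y :
  phi_E q c x xi yi * y = c%:A - (q - q^-1) ^- 2 *: (q^-1 *: x + q *: xi).
Proof. by rewrite /phi_E mulrBl -!scalerAl -mulrA yiy mulr1. Qed.

Lemma y_phi_E :
  y * phi_E q c x xi yi = c%:A - (q - q^-1) ^- 2 *: (q *: x + q^-1 *: xi).
Proof.
rewrite /phi_E mulrBr -!scalerAl -!scalerAr yyi mulrA; congr (_ - _ *: _).
rewrite mulrDr -!scalerAr yx yxi mulrDl -!scalerAl -!mulrA yyi !mulr1 !scalerA.
by rewrite expr2 mulKf // invfM mulrA mulfV // mul1r.
Qed.

Lemma phi_rels :
  {in uq_rels q (phi_E q c x xi yi) y x xi, forall u, u = 0}.
Proof.
move=> u; rewrite !inE => /or4P[|||/orP[]] /eqP->.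
- by rewrite xxi subrr.
- by rewrite xix subrr.
- set p := q^-1 *: x + q *: xi.
  have xp : x * p = p * x.
    by rewrite mulrDl mulrDr -!scalerAl -!scalerAr xix xxi.
  rewrite /phi_E -/p mulrBr mulrBl -!scalerAl -!scalerAr -scalerAl mulrA xp.
  rewrite -[p * x * yi]mulrA xyi -!scalerAl -!scalerAr -!scalerAl -!mulrA xxi.
  by rewrite !mulr1 scalerBr !scalerA ![q ^+ 2 * _]mulrC subrr.
- have -> : x * y = q ^- 2 *: (y * x) by rewrite yx scalerA mulVf ?scale1r.
  by rewrite -scalerAl -mulrA xxi mulr1 subrr.
- rewrite phi_E_y y_phi_E opprB [_ - _ + (_ - _)]addrC addrA subrK -scalerBr.
  have -> : q *: x + q^-1 *: xi - (q^-1 *: x + q *: xi) =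
            (q - q^-1) *: (x - xi).
    by rewrite opprD addrACA -!scalerBl scalerBr -[q^-1 - q]opprB scaleNr.
  rewrite scalerA; have [->|d0] := eqVneq (q - q^-1) 0.
    by rewrite invr0 mulr0 !scale0r subrr.
  by rewrite expr2 invfM mulfVK // subrr.
Qed.

Lemma phi_casimir : casimir q (phi_E q c x xi yi) y x xi = c%:A.
Proof. by rewrite /casimir phi_E_y subrK. Qed.

End RelationsTheory.

Arguments phi_rels {k S q} c {x xi y yi} q0 xyP.
Arguments phi_casimir {k S q} c {x xi y yi} xyP.


Lemma uq_relsP (k : fieldType) (S : algType k) (q : k) (e f K Ki : S) :
  {in uq_rels q e f K Ki, forall u, u = 0} ->
  [/\ K * Ki = 1, Ki * K = 1, K * e * Ki = q ^+ 2 *: e,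
      K * f * Ki = q ^- 2 *: f &
      e * f - f * e = (q - q^-1)^-1 *: (K - Ki)].
Proof.
by move=> rel; split; apply/subr0_eq/rel; rewrite !inE eqxx ?orbT.
Qed.

Lemma qt_relsP (k : fieldType) (S : algType k) (nu : k) (x xi y yi : S) :
  {in qt_rels nu x xi y yi, forall u, u = 0} ->
  [/\ x * xi = 1, xi * x = 1, y * yi = 1, yi * y = 1 &
      nu *: (x * y) = y * x].
Proof.
by move=> rel; split; apply/subr0_eq/rel; rewrite !inE eqxx ?orbT.
Qed.

Section CasimirCentral.
Variables (k : fieldType) (S : algType k) (q : k) (e f K Ki : S).
Hypotheses (q0 : q != 0) (q21 : q ^+ 2 != 1).
Hypothesis relP : {in uq_rels q e f K Ki, forall u, u = 0}.

Let KKi : K * Ki = 1.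
Proof. by apply/subr0_eq/relP; rewrite !inE eqxx. Qed.
Let KiK : Ki * K = 1.
Proof. by apply/subr0_eq/relP; rewrite !inE eqxx ?orbT. Qed.
Let KE : K * e = q ^+ 2 *: (e * K).
Proof.
have /subr0_eq H : K * e * Ki - q ^+ 2 *: e = 0.
  by apply/relP; rewrite !inE eqxx ?orbT.
by rewrite scalerAl -H -[RHS]mulrA KiK mulr1.
Qed.
Let KF : K * f = q ^- 2 *: (f * K).
Proof.
have /subr0_eq H : K * f * Ki - q ^- 2 *: f = 0.
  by apply/relP; rewrite !inE eqxx ?orbT.
by rewrite scalerAl -H -[RHS]mulrA KiK mulr1.
Qed.
Let EF : e * f =
  f * e + (q - q^-1)^-1 *: (K - Ki).
Proof.
have /subr0_eq <- : e * f - f * e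
    - (q - q^-1)^-1 *: (K - Ki) = 0.
  by apply/relP; rewrite !inE eqxx ?orbT.
by rewrite addrC subrK.
Qed.
Let KiE : Ki * e = q ^- 2 *: (e * Ki).
Proof.
rewrite -[e in LHS]mulr1 -KKi [e * _]mulrA.
have -> : e * K = q ^- 2 *: (K * e).
  by rewrite KE scalerA mulVf ?scale1r ?expf_neq0.
by rewrite -scalerAl -scalerAr !mulrA KiK mul1r.
Qed.
Let KiF : Ki * f = q ^+ 2 *: (f * Ki).
Proof.
rewrite -[f in LHS]mulr1 -KKi [f * _]mulrA.
have -> : f * K = q ^+ 2 *: (K * f).
  by rewrite KF scalerA mulfV ?scale1r ?expf_neq0.
by rewrite -scalerAl -scalerAr !mulrA KiK mul1r.
Qed.

Let qq0 : q - q^-1 != 0.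
Proof. by rewrite subr_eq0 -(inj_eq (mulfI q0)) -expr2 mulfV. Qed.

Let q2 : q ^+ 2 - 1 != 0. Proof. by rewrite subr_eq0. Qed.

Let P := q^-1 *: K + q *: Ki.
Let w := (q - q^-1)^-1.
Let casE : casimir q e f K Ki = e * f + w ^+ 2 *: P.
Proof. by rewrite /casimir /w exprVn. Qed.

Let KKiC : K * Ki = Ki * K. Proof. by rewrite KKi KiK. Qed.

Lemma casimirK : casimir q e f K Ki * K = K * casimir q e f K Ki.
Proof.
rewrite casE mulrDl mulrDr; congr (_ + _).
  rewrite mulrA KE -scalerAl -[e * K * f]mulrA KF -scalerAr scalerA mulfV ?scale1r ?mulrA //.
  exact: expf_neq0.
by rewrite -scalerAl -scalerAr /P mulrDl mulrDr -!scalerAl -!scalerAr KKiC.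
Qed.

Lemma casimirKi : casimir q e f K Ki * Ki = Ki * casimir q e f K Ki.
Proof.
rewrite -[LHS]mul1r -KiK -mulrA [K * _]mulrA -casimirK -[_ * K * Ki]mulrA KKi.
by rewrite mulr1.
Qed.

Lemma casimirE : casimir q e f K Ki * e = e * casimir q e f K Ki.
Proof.
rewrite casE mulrDl mulrDr -[e * f * e]mulrA.
have -> : f * e = e * f - w *: (K - Ki) by rewrite EF addrK.
rewrite mulrBr -addrA; congr (_ + _).
rewrite -scalerAl -!scalerAr /P mulrDl -!scalerAl KE KiE !scalerA.
rewrite mulrBr mulrDr -!scalerAr.
have -> : q^-1 * q ^+ 2 = q by rewrite expr2 mulKf.
have -> : q * q ^- 2 = q^-1 by rewrite expr2 invfM mulrA mulfV // mul1r.
rewrite scalerBr opprB [_ *: _ - _]addrC !scalerDr !scalerA addrACA -scaleNr -!scalerDl.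
by congr (_ *: _ + _ *: _); rewrite /w; field; rewrite ?q0 ?q2.
Qed.

Lemma casimirF : casimir q e f K Ki * f = f * casimir q e f K Ki.
Proof.
rewrite casE mulrDl mulrDr {1}EF mulrDl -[f * e * f]mulrA -addrA; congr (_ + _).
rewrite -!scalerAl -!scalerAr /P mulrBl mulrDl mulrDr -!scalerAl -!scalerAr.
rewrite KF KiF scalerBr !scalerDr !scalerA addrACA -scaleNr -!scalerDl.
by congr (_ *: _ + _ *: _); rewrite /w; field; rewrite ?q0 ?q2.
Qed.

End CasimirCentral.

Variant uq_gen := gE | gF | gK | gKi.

Definition uq_gen_code (g : uq_gen) : nat :=
  match g with gE => 0 | gF => 1 | gK => 2 | gKi => 3 end.
Definition uq_gen_decode (n : nat) : uq_gen :=
  match n with 0 => gE | 1 => gF | 2 => gK | _ => gKi end.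
Lemma uq_gen_codeK : cancel uq_gen_code uq_gen_decode.
Proof. by case. Qed.
HB.instance Definition _ := Choice.copy uq_gen (can_type uq_gen_codeK).

Variant qt_gen := gx | gxi | gy | gyi.

Definition qt_gen_code (g : qt_gen) : nat :=
  match g with gx => 0 | gxi => 1 | gy => 2 | gyi => 3 end.
Definition qt_gen_decode (n : nat) : qt_gen :=
  match n with 0 => gx | 1 => gxi | 2 => gy | _ => gyi end.
Lemma qt_gen_codeK : cancel qt_gen_code qt_gen_decode.
Proof. by case. Qed.
HB.instance Definition _ := Choice.copy qt_gen (can_type qt_gen_codeK).

Lemma map_ker (A B : eqType) (z : B) (f : A -> B) (s : seq A) :
  {in map f s, forall u, u = z} -> {in s, forall u, f u = z}.
Proof. by move=> fs u us; apply/fs/map_f. Qed.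

Section QuantumTorus.
Variables (k : fieldType).

Definition qt_free_rels (nu : k) : seq (free_alg k qt_gen) :=
  qt_rels nu (fgen k gx) (fgen k gxi) (fgen k gy) (fgen k gyi).

Section Iota.
Variables (nu : k) (nu0 : nu != 0).

Definition lt_gen (g : qt_gen) : loc_torus nu0 :=
  match g with
  | gx => lt_x nu0 | gxi => lt_xi nu0 | gy => lt_y nu0 | gyi => lt_yi nu0
  end.

Lemma lt_rels :
  {in qt_rels nu (lt_x nu0) (lt_xi nu0) (lt_y nu0) (lt_yi nu0),
   forall u, u = 0}.
Proof.
have X0 : 'X%:F != 0 :> {fraction {poly k}} by rewrite tofrac_eq0 polyX_eq0.
have aut0 a : aut_exp (dilation_aut nu0) 0 a = a by [].
move=> u; rewrite !inE => /or4P[|||/orP[]] /eqP->; apply/eqP; rewrite subr_eq0;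
  apply/eqP.
- by rewrite [LHS]sl_termM aut0 mulfV.
- by rewrite [LHS]sl_termM aut0 mulVf.
- by rewrite [LHS]sl_termM mul1r rmorph1.
- by rewrite [LHS]sl_termM mul1r rmorph1.
rewrite -[LHS]/(lt_const nu0 nu * _) mulrA [lt_const _ _ * _]sl_termM aut0.
rewrite [LHS]sl_termM [RHS]sl_termM rmorph1 mul1r mulr1 !addr0 add0r.
rewrite [aut_exp _ _ _]dilation_tofrac /dil_poly comp_polyX -mul_polyC.
by rewrite rmorphM.
Qed.

Lemma lt_eval_rels : {in qt_free_rels nu, forall u, free_eval lt_gen u = 0}.
Proof. by apply: map_ker; rewrite qt_rels_map /= !free_eval_gen; exact: lt_rels. Qed.

Lemma qt_proper : 1 \notin gen_ideal (qt_free_rels nu).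
Proof. exact: gen_ideal_proper lt_eval_rels. Qed.

End Iota.
End QuantumTorus.

Arguments qt_proper {k nu} nu0.
Notation qtorus nu0 := (quot_alg (qt_proper nu0)).

HB.lock Definition qt_x (k : fieldType) (nu : k) (nu0 : nu != 0) :
  qtorus nu0 := qproj (qt_proper nu0) (fgen k gx).
HB.lock Definition qt_xi (k : fieldType) (nu : k) (nu0 : nu != 0) :
  qtorus nu0 := qproj (qt_proper nu0) (fgen k gxi).
HB.lock Definition qt_y (k : fieldType) (nu : k) (nu0 : nu != 0) :
  qtorus nu0 := qproj (qt_proper nu0) (fgen k gy).
HB.lock Definition qt_yi (k : fieldType) (nu : k) (nu0 : nu != 0) :
  qtorus nu0 := qproj (qt_proper nu0) (fgen k gyi).

(* the embedding of R into its localization S^-1 R *)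
Definition qt_iota (k : fieldType) (nu : k) (nu0 : nu != 0) :
    {lrmorphism qtorus nu0 -> loc_torus nu0} :=
  quot_lift (qt_proper nu0) (lt_eval_rels nu0).

Lemma qt_relations (k : fieldType) (nu : k) (nu0 : nu != 0) :
  {in qt_rels nu (qt_x nu0) (qt_xi nu0) (qt_y nu0) (qt_yi nu0),
   forall u, u = 0}.
Proof.
rewrite qt_x.unlock qt_xi.unlock qt_y.unlock qt_yi.unlock.
rewrite -(qt_rels_map (qproj (qt_proper nu0))) => _ /mapP[u urel ->].
rewrite -(raddf0 (qproj (qt_proper nu0))); apply/qproj_eq.
by rewrite subr0 gen_ideal_sub.
Qed.

Arguments qt_relations {k nu} nu0.

Lemma qt_iota_gen (k : fieldType) (nu : k) (nu0 : nu != 0) :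
  [/\ qt_iota nu0 (qt_x nu0) = lt_x nu0, qt_iota nu0 (qt_xi nu0) = lt_xi nu0,
      qt_iota nu0 (qt_y nu0) = lt_y nu0 & qt_iota nu0 (qt_yi nu0) = lt_yi nu0].
Proof.
rewrite qt_x.unlock qt_xi.unlock qt_y.unlock qt_yi.unlock.
by split; rewrite [LHS]quot_liftE [LHS]free_eval_gen.
Qed.

Arguments lt_rels {k nu} nu0.

Section Uq.
Variables (k : fieldType) (q : k).

Definition uq_free_rels : seq (free_alg k uq_gen) :=
  uq_rels q (fgen k gE) (fgen k gF) (fgen k gK) (fgen k gKi).

(* nontriviality of U_q(sl_2), by its trivial representation *)
Lemma uq_proper : 1 \notin gen_ideal uq_free_rels.
Proof.
pose g (i : uq_gen) : k^o := match i with gE | gF => 0 | gK | gKi => 1 end.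
apply: (@gen_ideal_proper _ _ _ _ (free_eval g)); apply: map_ker.
rewrite uq_rels_map /= !free_eval_gen /g => u; rewrite !inE.
by rewrite !(mulr0, mul0r, mulr1, subrr, scaler0) !orbb => /eqP.
Qed.
End Uq.

Notation uq q := (quot_alg (uq_proper q)).

HB.lock Definition uq_E (k : fieldType) (q : k) : uq q :=
  qproj (uq_proper q) (fgen k gE).
HB.lock Definition uq_F (k : fieldType) (q : k) : uq q :=
  qproj (uq_proper q) (fgen k gF).
HB.lock Definition uq_K (k : fieldType) (q : k) : uq q :=
  qproj (uq_proper q) (fgen k gK).
HB.lock Definition uq_Ki (k : fieldType) (q : k) : uq q :=
  qproj (uq_proper q) (fgen k gKi).

HB.lock Definition Zq (k : fieldType) (q : k) : uq q :=
  casimir q (uq_E q) (uq_F q) (uq_K q) (uq_Ki q).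

Section UqTheory.
Variables (k : fieldType) (q : k).
Local Notation uq := (uq q).
Local Notation uq_E := (uq_E q).
Local Notation uq_F := (uq_F q).
Local Notation uq_K := (uq_K q).
Local Notation uq_Ki := (uq_Ki q).
Local Notation Zq := (Zq q).
Local Notation uq_proper := (uq_proper q).
Local Notation uq_free_rels := (uq_free_rels q).

Let qproj_gen (g : uq_gen) : qproj uq_proper (fgen k g) =
  match g with gE => uq_E | gF => uq_F | gK => uq_K | gKi => uq_Ki end.
Proof.
by case: g; rewrite (uq_E.unlock, uq_F.unlock, uq_K.unlock, uq_Ki.unlock).
Qed.

Lemma uq_relations : {in uq_rels q uq_E uq_F uq_K uq_Ki, forall u, u = 0}.
Proof.
rewrite uq_E.unlock uq_F.unlock uq_K.unlock uq_Ki.unlock.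
rewrite -(uq_rels_map (qproj uq_proper)) => _ /mapP[u urel ->].
rewrite -(raddf0 (qproj uq_proper)); apply/qproj_eq.
by rewrite subr0 gen_ideal_sub.
Qed.

Lemma uq_ind (P : uq -> Prop) :
  P uq_E -> P uq_F -> P uq_K -> P uq_Ki -> P 1 ->
  (forall u v, P u -> P v -> P (u * v)) ->
  (forall (a : k) u v, P u -> P v -> P (a *: u + v)) ->
  forall u, P u.
Proof.
move=> PE PF PK PKi P1 PM PL u; rewrite -[u](qproj_repr (X1 := uq_proper)).
have P0 : P 0 by have := PL (-1) 1 1 P1 P1; rewrite scaleN1r addNr.
have qZ a v : qproj uq_proper (a *: v) = a *: qproj uq_proper v.
  exact: linearZ.
rewrite [repr u]free_algE raddf_sum; elim: (enum_fset _) => [|m s IH].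
  by rewrite big_nil.
rewrite big_cons [X in X + _]qZ; apply: (PL _ _ _ _ IH) => {s IH}.
rewrite rmorph_prod; elim: (fmonom_val m) => [|i s IH]; first by rewrite big_nil.
by rewrite big_cons; apply: (PM _ _ _ IH) => {IH}; rewrite [X in P X]qproj_gen; case: i.
Qed.

Section Lift.
Variables (S : algType k) (e f K Ki : S).
Hypothesis relS : {in uq_rels q e f K Ki, forall u, u = 0}.

Definition uq_gen_val of {in uq_rels q e f K Ki, forall u, u = 0} :=
  fun g : uq_gen => match g with gE => e | gF => f | gK => K | gKi => Ki end.

Lemma uq_eval_rels :
  {in uq_free_rels, forall u, free_eval (uq_gen_val relS) u = 0}.
Proof. by apply: map_ker; rewrite uq_rels_map /= !free_eval_gen. Qed.

Definition uq_lift : {lrmorphism uq -> S} := quot_lift uq_proper uq_eval_rels.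

Lemma uq_lift_gen : [/\ uq_lift uq_E = e, uq_lift uq_F = f,
  uq_lift uq_K = K & uq_lift uq_Ki = Ki].
Proof.
rewrite uq_E.unlock uq_F.unlock uq_K.unlock uq_Ki.unlock.
by split; rewrite [LHS]quot_liftE [LHS]free_eval_gen.
Qed.

Lemma uq_lift_Zq : uq_lift Zq = casimir q e f K Ki.
Proof.
by case: uq_lift_gen => hE hF hK hKi; rewrite Zq.unlock casimir_map hE hF hK hKi.
Qed.
End Lift.

End UqTheory.

Lemma Zq_central (k : fieldType) (q : k) : q != 0 -> q ^+ 2 != 1 ->
  forall u : uq q, Zq q * u = u * Zq q.
Proof.
move=> q0 q21; apply: uq_ind => [|||||u v uP vP|a u v uP vP].
- by rewrite Zq.unlock; exact: casimirE q0 q21 (@uq_relations k q).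
- by rewrite Zq.unlock; exact: casimirF q0 q21 (@uq_relations k q).
- by rewrite Zq.unlock; exact: casimirK q0 (@uq_relations k q).
- by rewrite Zq.unlock; exact: casimirKi q0 (@uq_relations k q).
- by rewrite mulr1 mul1r.
- by rewrite mulrA uP -mulrA vP mulrA.
- by rewrite mulrDr [RHS]mulrDl -scalerAr -scalerAl uP vP.
Qed.

Section Uc.
Variables (k : fieldType) (q : k) (q0 : q != 0) (c : k).

Let nu0 : q ^+ 2 != 0 := expf_neq0 2 q0.

(* By uc_idealE below, the two-sided ideal this generates is (Zq - c) U_q. *)
Definition uc_rels : seq (uq q) := [:: Zq q - c%:A].

Lemma uc_idealE (u : uq q) : q ^+ 2 != 1 ->
  (u \in gen_ideal uc_rels) <-> (exists v, u = (Zq q - c%:A) * v).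
Proof.
move=> q21; have ZC v : (Zq q - c%:A) * v = v * (Zq q - c%:A).
  by rewrite mulrBl mulrBr Zq_central // mulr_algl mulr_algr.
split=> [/gen_idealP|[v ->]]; last first.
  have [_ idM] := gen_ideal_ideal uc_rels.
  by apply: (idM v _ _).2; rewrite gen_ideal_sub // inE.
move=> /(_ (fun u => `[< exists v, u = (Zq q - c%:A) * v >])) H.
apply/asboolP/H => [|v]; last first.
  by rewrite inE => /eqP->; apply/asboolP; exists 1; rewrite mulr1.
split; first split.
- by apply/asboolP; exists 0; rewrite mulr0.
- move=> _ _ /asboolP[v ->] /asboolP[v' ->]; apply/asboolP.
  by exists (v - v'); rewrite mulrBr.
- move=> a _ /asboolP[v ->]; split; apply/asboolP.
  + by exists (a * v); rewrite mulrA -ZC mulrA.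
  + by exists (v * a); rewrite mulrA.
Qed.

Lemma uc_proper : 1 \notin gen_ideal uc_rels.
Proof.
have B_rels := phi_rels c q0 (lt_rels nu0).
apply: (@gen_ideal_proper _ _ _ _ (uq_lift B_rels)) => u; rewrite inE => /eqP->.
rewrite rmorphB [X in X - _]uq_lift_Zq (phi_casimir c (lt_rels nu0)).
by rewrite [X in _ - X]rmorph_alg subrr.
Qed.

End Uc.

Notation uc q0 c := (quot_alg (uc_proper q0 c)).

Definition uc_proj (k : fieldType) (q : k) (q0 : q != 0) (c : k) :
  {lrmorphism uq q -> uc q0 c} := qproj (uc_proper q0 c).

HB.lock Definition uc_E (k : fieldType) (q : k) (q0 : q != 0) (c : k) :
  uc q0 c := uc_proj q0 c (uq_E q).
HB.lock Definition uc_F (k : fieldType) (q : k) (q0 : q != 0) (c : k) :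
  uc q0 c := uc_proj q0 c (uq_F q).
HB.lock Definition uc_K (k : fieldType) (q : k) (q0 : q != 0) (c : k) :
  uc q0 c := uc_proj q0 c (uq_K q).
HB.lock Definition uc_Ki (k : fieldType) (q : k) (q0 : q != 0) (c : k) :
  uc q0 c := uc_proj q0 c (uq_Ki q).

Section UcTheory.
Variables (k : fieldType) (q : k) (q0 : q != 0) (c : k).
Local Notation nu0 := (expf_neq0 2 q0).
Local Notation uc := (uc q0 c).
Local Notation uc_proper := (uc_proper q0 c).
Local Notation uc_rels := (uc_rels q c).
Local Notation E := (uc_E q0 c).
Local Notation F := (uc_F q0 c).
Local Notation K := (uc_K q0 c).
Local Notation Ki := (uc_Ki q0 c).

Let ucE := (uc_E.unlock, uc_F.unlock, uc_K.unlock, uc_Ki.unlock).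

Lemma uc_relations : {in uq_rels q E F K Ki, forall u, u = 0}.
Proof.
rewrite !ucE -(uq_rels_map (uc_proj q0 c)) => _ /mapP[u urel ->].
by rewrite (uq_relations urel) raddf0.
Qed.

Lemma uc_casimir : casimir q E F K Ki = c%:A.
Proof.
rewrite !ucE -(casimir_map (uc_proj q0 c)) -(rmorph_alg (uc_proj q0 c)).
rewrite (_ : casimir _ _ _ _ _ = Zq q); last by rewrite Zq.unlock.
by apply/(qproj_eq uc_proper); rewrite gen_ideal_sub // inE.
Qed.

Lemma uc_ind (P : uc -> Prop) :
  P E -> P F -> P K -> P Ki -> P 1 ->
  (forall u v, P u -> P v -> P (u * v)) ->
  (forall (a : k) u v, P u -> P v -> P (a *: u + v)) ->
  forall u, P u.
Proof.
rewrite !ucE => PE PF PK PKi P1 PM PL u; rewrite -[u](qproj_repr (X1 := uc_proper)).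
elim/uq_ind: (repr u) => // [v w Pv Pw|a v w Pv Pw].
- by rewrite rmorphM; apply: PM.
- by rewrite linearP; apply: PL.
Qed.

Local Notation R := (qtorus nu0).

Definition uq_phi : {lrmorphism uq q -> R} :=
  uq_lift (phi_rels c q0 (qt_relations nu0)).

Lemma uq_phi_Zq : {in uc_rels, forall u, uq_phi u = 0}.
Proof.
move=> u; rewrite inE => /eqP->.
rewrite rmorphB [X in X - _]uq_lift_Zq (phi_casimir c (qt_relations nu0)).
by rewrite [X in _ - X]rmorph_alg subrr.
Qed.

Definition phi : {lrmorphism uc -> R} := quot_lift uc_proper uq_phi_Zq.

Lemma phi_gen : [/\ phi E = phi_E q c (qt_x nu0) (qt_xi nu0) (qt_yi nu0),
  phi F = qt_y nu0, phi K = qt_x nu0 & phi Ki = qt_xi nu0].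
Proof.
have [hE hF hK hKi] := uq_lift_gen (phi_rels c q0 (qt_relations nu0)).
by rewrite !ucE; split; rewrite [LHS]quot_liftE.
Qed.

End UcTheory.

Section LeftModules.

(* restriction of scalars *)
Definition restr (A B : pzRingType) (f : {rmorphism A -> B}) (V : lmodType B) :
  Type := V.

Variables (A B : pzRingType) (f : {rmorphism A -> B}).

Section Restr.
Variable V : lmodType B.
HB.instance Definition _ := GRing.Zmodule.on (restr f V).

Definition restr_scale (a : A) (v : restr f V) : restr f V := f a *: (v : V).
Lemma restr_scaleA a b v :
  restr_scale a (restr_scale b v) = restr_scale (a * b) v.
Proof. by rewrite /restr_scale rmorphM scalerA. Qed.
Lemma restr_scale1 : left_id 1 restr_scale.
Proof. by move=> v; rewrite /restr_scale rmorph1 scale1r. Qed.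
Lemma restr_scaleDr : right_distributive restr_scale +%R.
Proof. by move=> a u v; rewrite /restr_scale scalerDr. Qed.
Lemma restr_scaleDl v : {morph restr_scale^~ v : a b / a + b}.
Proof. by move=> a b; rewrite /restr_scale rmorphD scalerDl. Qed.
HB.instance Definition _ := GRing.Zmodule_isLmodule.Build A (restr f V)
  restr_scaleA restr_scale1 restr_scaleDr restr_scaleDl.
End Restr.

Variable alpha : B.

(* the left ideal B alpha *)
Definition left_ideal : {pred B^o} := fun b => `[< exists d, b = d * alpha >].

Lemma left_idealP (b : B^o) :
  reflect (exists d : B, b = d * alpha) (b \in left_ideal).
Proof. exact: asboolP. Qed.

Fact left_ideal_submod : submod_closed left_ideal.
Proof.
split=> [|a u v /left_idealP[d ->] /left_idealP[e ->]]; apply/left_idealP.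
  by exists 0; rewrite mul0r.
by exists (a * d + e); rewrite mulrDl -mulrA.
Qed.
HB.instance Definition _ := GRing.isSubmodClosed.Build B B^o left_ideal
  left_ideal_submod.

(* The A-submodule (f(A) + B alpha) / B alpha of B / B alpha *)
Definition image_quot_pred : {pred restr f (lquot left_ideal)} :=
  fun z => `[< exists (a : A) (b : B), z = lproj left_ideal (f a + b * alpha) >].

Lemma image_quotP (z : restr f (lquot left_ideal)) :
  reflect (exists (a : A) (b : B), z = lproj left_ideal (f a + b * alpha))
          (z \in image_quot_pred).
Proof. exact: asboolP. Qed.

Fact image_quot_submod : submod_closed image_quot_pred.
Proof.
split=> [|u y z]; first by apply/image_quotP; exists 0, 0;
  rewrite rmorph0 mul0r addr0 raddf0.
move=> /image_quotP[a [b ->]] /image_quotP[a' [b' ->]]; apply/image_quotP.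
exists (u * a + a'), (f u * b + b').
rewrite -[_ *: _]/(f u *: lproj left_ideal _) -linearZ -raddfD; congr lproj.
rewrite -[_ *: _]/(f u * _) rmorphD rmorphM mulrDl mulrDr !mulrA.
exact: addrACA.
Qed.
HB.instance Definition _ := GRing.isSubmodClosed.Build A
  (restr f (lquot left_ideal)) image_quot_pred image_quot_submod.

Definition image_quot := {z | z \in image_quot_pred}.
HB.instance Definition _ := SubChoice.on image_quot.
HB.instance Definition _ := [SubChoice_isSubLmodule of image_quot by <:].

End LeftModules.

Definition is_unit (A : pzRingType) (a : A) : Prop :=
  exists b, a * b = 1 /\ b * a = 1.

Definition irreducible_elt (A : pzRingType) (a : A) : Prop :=
  [/\ a <> 0, ~ is_unit a &
      forall b c, a = b * c -> is_unit b \/ is_unit c].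

Definition simple_module (A : pzRingType) (V : lmodType A) : Prop :=
  (exists v : V, v <> 0) /\
  (forall W : {pred V}, submod_closed W ->
     (forall v, v \in W -> v = 0) \/ (forall v, v \in W)).

Definition lmod_isomorphic (A : pzRingType) (V W : lmodType A) : Prop :=
  exists h : {linear V -> W}, bijective h.

Section UcModules.
Variables (k : fieldType) (q : k) (q0 : q != 0) (c : k).
Local Notation U := (uc q0 c).
Local Notation E := (uc_E q0 c).
Local Notation F := (uc_F q0 c).
Local Notation K := (uc_K q0 c).

Section Weights.
Variable V : lmodType U.

(* the underlying k-vector space structure of V *)
Definition kscale (a : k) (v : V) : V := (a%:A : U) *: v.

Definition generated_by (v : V) : Prop := forall w, exists u : U, w = u *: v.

Definition highest_weight_module : Prop :=
  exists (v : V) (lambda : k),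
    [/\ v <> 0, generated_by v, lambda <> 0,
        K *: v = kscale lambda v & E *: v = 0].

Definition lowest_weight_module : Prop :=
  exists (v : V) (lambda : k),
    [/\ v <> 0, generated_by v, lambda <> 0,
        K *: v = kscale lambda v & F *: v = 0].

Definition kbasis (v : int -> V) : Prop :=
  forall w, exists! a : {malg k[int]},
    w = \sum_(i <- msupp a) kscale a@_i (v i).

Definition intermediate_series : Prop :=
  simple_module V /\
  exists (v : int -> V) (lambda : k),
    [/\ kbasis v, lambda <> 0 &
     forall i : int,
       [/\ K *: v i = kscale (lambda * q ^ (2 * i)) (v i),
           exists2 a : k, a <> 0 & E *: v i = kscale a (v (i + 1)) &
           exists2 b : k, b <> 0 & F *: v i = kscale b (v (i - 1))]].

End Weights.

Local Notation R := (qtorus (expf_neq0 2 q0)).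
Local Notation B := (loc_torus (expf_neq0 2 q0)).
Local Notation iota := (qt_iota (expf_neq0 2 q0)).

Definition R_c (r : R) : Prop := exists u : U, r = phi q0 c u.

(* phi followed by the inclusion of R in B *)
Definition phiB : {rmorphism U -> B} := iota \o phi q0 c.

(* (R_c + B alpha) / B alpha, as a U_c-module via phi *)
Definition RcB_module (alpha : R) : lmodType U :=
  image_quot phiB (iota alpha).

End UcModules.

(* Main.v *)
(** If some nonzero [f(K)] kills a nonzero vector, then [K] has an eigenvector [v].
    On weight vectors [E F] and [F E] act as scalars, because the Casimir element
    does; so either [E] or [F] kills some weight vector, or the vectors [E^i v] and
    [F^i v] form the basis of a module of intermediate series.

    Otherwise [V] is torsion-free over [C[K]]. Every [u] in [U_c] is brought by some
    [K^m F^N u] to the form [sum p_i(K) F^i], so [U_c] acts on [V] through its image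
    in [B], and [B] arises from that image by inverting the [f(x)] and [y], which
    act injectively on [V]. For [v <> 0] let [alpha] be an element of minimal degree
    in [y] in the image of the annihilator of [v]. Right division in [C(x)[y]]
    followed by clearing denominators shows that [u v = 0] iff the image of [u] lies
    in [B alpha]; whence [V = (R_c + B alpha) / B alpha], and the maximality of the
    annihilator of [v] makes [alpha] irreducible. *)
Require Import Defs.
From HB Require Import structures.
From mathcomp Require Import all_boot all_order all_algebra.
From mathcomp Require Import fraction finmap boolp zify monalg.
From mathcomp Require Import reals complex.

Set Implicit Arguments.
Unset Strict Implicit.
Unset Printing Implicit Defensive.

Import Order.TTheory GRing.Theory Num.Theory.

Local Open Scope ring_scope.

(** The multiples of [v] form a submodule, which is nonzero because it contains [v]. *)
Lemma simple_module_generated (A : pzRingType) (V : lmodType A) (v : V) :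
  simple_module V -> v <> 0 -> forall w : V, exists u : A, w = u *: v.
Proof.
move=> [_ simV] v0 w; pose W : {pred V} := fun w => `[< exists u, w = u *: v >].
have [|W0|/(_ w)/asboolP//] := simV W.
  split=> [|a x y /asboolP[u ->] /asboolP[u' ->]]; apply/asboolP.
    by exists 0; rewrite scale0r.
  by exists (a * u + u'); rewrite scalerDl scalerA.
by case: v0; apply: W0; apply/asboolP; exists 1; rewrite scale1r.
Qed.

(** * Eigenvectors *)

Section CentralScalars.
Variables (k : fieldType) (A : algType k) (V : lmodType A).
Implicit Types (a b : k) (u : A) (v : V).

(** [V] is a module over [A] alone, so scalars act through [a%:A]; this rule and the next ones move
    them about as in a vector space over [k]. *)
Lemma mulr_algC u a : u * a%:A = a%:A * u.
Proof. by rewrite mulr_algl mulr_algr. Qed.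

Lemma scalerl_alg a u v : (a *: u) *: v = a%:A *: (u *: v).
Proof. by rewrite scalerA mulr_algl. Qed.

Lemma scaler_algA a b v : a%:A *: (b%:A *: v) = (a * b)%:A *: v.
Proof. by rewrite scalerA mulr_algl scalerA. Qed.

Lemma scaler_algC u a v : u *: (a%:A *: v) = a%:A *: (u *: v).
Proof. by rewrite !scalerA mulr_algC. Qed.

Lemma scale0_alg v : (0 : k)%:A *: v = 0.
Proof. by rewrite scale0r scale0r. Qed.

Lemma scale1_alg v : (1 : k)%:A *: v = v.
Proof. by rewrite scale1r scale1r. Qed.

Lemma scaler_alg_eq0 a v : a%:A *: v = 0 -> a <> 0 -> v = 0.
Proof.
move=> av0 /eqP a0.
by rewrite -[v]scale1_alg -(mulVf a0) -scaler_algA av0 scaler0.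
Qed.

Lemma horner_alg_eigen (u : A) (lam : k) v (f : {poly k}) :
  u *: v = lam%:A *: v -> horner_alg u f *: v = (f.[lam])%:A *: v.
Proof.
move=> uv; elim/poly_ind: f => [|f a IH].
  by rewrite raddf0 horner0 scale0_alg scale0r.
rewrite hornerMXaddC rmorphD rmorphM /= horner_algX horner_algC.
rewrite [LHS]scalerDl -scalerA uv scaler_algC IH scaler_algA mulrC.
by rewrite -!scalerDl.
Qed.

End CentralScalars.

(** Over an algebraically closed field [f] splits into linear factors. When these are applied one
    after another, the last nonzero vector is an eigenvector. *)
Lemma torsion_eigenvector (k : closedFieldType) (A : algType k) (V : lmodType A)
    (u : A) (f : {poly k}) (v : V) :
  f != 0 -> v <> 0 -> horner_alg u f *: v = 0 ->
  exists (w : V) (lam : k), w <> 0 /\ u *: w = lam%:A *: w.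
Proof.
move=> f0; have [rs ->] := closed_field_poly_normal f.
rewrite -mul_polyC rmorphM /= horner_algC -scalerA => v0 fv0.
have l0 : lead_coef f <> 0 by apply/eqP; rewrite lead_coef_eq0.
move: fv0 => /scaler_alg_eq0/(_ l0) {l0 f0}.
elim: rs v v0 => [|a rs IH] v v0.
  by rewrite big_nil rmorph1 scale1r.
rewrite big_cons mulrC rmorphM -scalerA => prod0.
have [eqv|neqv] := EM (horner_alg u ('X - a%:P) *: v = 0); last exact: IH neqv _.
exists v, a; split=> //; apply/subr0_eq; rewrite -eqv.
by rewrite raddfB /= horner_algX horner_algC scalerBl.
Qed.

(** * Weight modules *)

Section LinearCombinations.
Variables (k : fieldType) (A : algType k) (V : lmodType A) (I : choiceType).
Variable v : I -> V.
Implicit Types a b : {malg k[I]}.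

(** The form is chosen to be convertible to the sum in [kbasis]. *)
Definition lincomb a : V := \sum_(i <- msupp a) (a@_i)%:A *: v i.

Lemma lincombE (d : {fset I}) a : (msupp a `<=` d)%fset ->
  lincomb a = \sum_(i <- d) (a@_i)%:A *: v i.
Proof.
move=> le; rewrite /lincomb (big_fset_incl _ le) //= => i _ /mcoeff_outdom ->.
exact: scale0_alg.
Qed.

Lemma lincombD a b : lincomb (a + b) = lincomb a + lincomb b.
Proof.
rewrite (lincombE (msuppD_le a b)) (lincombE (fsubsetUl _ (msupp b))).
rewrite (lincombE (fsubsetUr (msupp a) _)) -big_split /=.
by apply: eq_bigr => i _; rewrite mcoeffD !scalerDl.
Qed.

Lemma lincombZ (l : k) a : lincomb (l *: a) = l%:A *: lincomb a.
Proof.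
rewrite (lincombE (msuppZ_le _ _)) /lincomb scaler_sumr.
by apply: eq_bigr => i _; rewrite mcoeffZ scaler_algA.
Qed.

Lemma lincombU i : lincomb (mkmalgU i 1) = v i.
Proof.
by rewrite (lincombE msuppU_le) big_seq_fset1 mcoeffUU scale1_alg.
Qed.

(** A polynomial in [u] that vanishes at all eigenvalues of the support except [mu i] isolates the
    term of index [i]. *)
Lemma lincomb_eq0 (u : A) (mu : I -> k) a : injective mu ->
  (forall i, v i <> 0) -> (forall i, u *: v i = (mu i)%:A *: v i) ->
  lincomb a = 0 -> a = 0.
Proof.
move=> mu_inj v0 uv comb0; apply/malgP => i; rewrite mcoeff0; apply/eqP.
apply/negP => /negP ai0; case: (v0 i).
have si : i \in msupp a by rewrite -mcoeff_neq0.
pose g := \prod_(j <- msupp a | j != i) ('X - (mu j)%:P).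
have gi : g.[mu i] <> 0.
  apply/eqP; rewrite horner_prod prodf_seq_neq0.
  apply/allP => j _; apply/implyP => ji.
  by rewrite hornerXsubC subr_eq0 (inj_eq mu_inj) eq_sym.
have gj j : j \in msupp a -> j != i -> g.[mu j] = 0.
  move=> sj ji; apply/eqP; rewrite horner_prod prodf_seq_eq0.
  apply/hasP; exists j => //=.
  by rewrite ji hornerXsubC subrr eqxx.
have : horner_alg u g *: lincomb a = 0 by rewrite comb0 scaler0.
rewrite /lincomb scaler_sumr (big_fsetD1 i) //= big1_seq => [|j]; last first.
  rewrite !inE => /andP[_ /andP[ji sj]].
  by rewrite scaler_algC (horner_alg_eigen _ (uv j)) gj // scale0_alg scaler0.
rewrite addr0 scaler_algC (horner_alg_eigen _ (uv i)).
by move=> /scaler_alg_eq0/(_ (elimN eqP ai0))/scaler_alg_eq0/(_ gi).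
Qed.

End LinearCombinations.

(** * Weight vectors and the action of E and F on them *)

Section UqModule.
Variables (k : fieldType) (q c : k) (A : algType k) (E F K Ki : A).
Hypothesis relA : {in uq_rels q E F K Ki, forall u, u = 0}.
Hypothesis casA : casimir q E F K Ki = c%:A.
Hypothesis q0 : q != 0.

Lemma uq_KE : K * E = q ^+ 2 *: (E * K).
Proof.
have [_ KiK KE _ _] := uq_relsP relA.
by rewrite scalerAl -KE -[RHS]mulrA KiK mulr1.
Qed.

Lemma uq_KF : K * F = q ^- 2 *: (F * K).
Proof.
have [_ KiK _ KF _] := uq_relsP relA.
by rewrite scalerAl -KF -[RHS]mulrA KiK mulr1.
Qed.

Lemma uq_EF : E * F = c%:A - (q - q^-1) ^- 2 *: (q^-1 *: K + q *: Ki).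
Proof. by rewrite -casA addrK. Qed.

Lemma uq_FE : F * E = E * F - (q - q^-1)^-1 *: (K - Ki).
Proof. by have [_ _ _ _ <-] := uq_relsP relA; rewrite opprB addrC subrK. Qed.

Variable V : lmodType A.
Implicit Types (v : V) (lam : k).

Lemma weight_neq0 v lam : v <> 0 -> K *: v = lam%:A *: v -> lam <> 0.
Proof.
have [_ KiK _ _ _] := uq_relsP relA.
move=> v0 Kv lam0; apply: v0.
by rewrite -[v]scale1r -KiK -scalerA Kv lam0 scale0_alg scaler0.
Qed.

Lemma weight_Ki v lam : v <> 0 -> K *: v = lam%:A *: v ->
  Ki *: v = (lam^-1)%:A *: v.
Proof.
have [_ KiK _ _ _] := uq_relsP relA.
move=> v0 Kv; have /eqP lam0 := weight_neq0 v0 Kv.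
have KiKv : Ki *: (K *: v) = v by rewrite scalerA KiK scale1r.
by rewrite -[in RHS]KiKv Kv scaler_algC scaler_algA mulVf // scale1_alg.
Qed.

Lemma weight_E v lam : K *: v = lam%:A *: v ->
  K *: (E *: v) = (lam * q ^+ 2)%:A *: (E *: v).
Proof.
move=> Kv; rewrite scalerA uq_KE scalerl_alg -scalerA Kv.
by rewrite scaler_algC scaler_algA mulrC.
Qed.

Lemma weight_F v lam : K *: v = lam%:A *: v ->
  K *: (F *: v) = (lam * q ^- 2)%:A *: (F *: v).
Proof.
move=> Kv; rewrite scalerA uq_KF scalerl_alg -scalerA Kv.
by rewrite scaler_algC scaler_algA mulrC.
Qed.

(** By [uq_EF], [E * F] is a linear combination of 1, [K] and [Ki], each of which acts on [v] by a
    scalar. *)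
Lemma weight_EF v lam : v <> 0 -> K *: v = lam%:A *: v ->
  exists a : k, E *: (F *: v) = a%:A *: v.
Proof.
move=> v0 Kv; have Kiv := weight_Ki v0 Kv.
exists (c - (q - q^-1) ^- 2 * (q^-1 * lam + q * lam^-1)).
rewrite scalerA uq_EF scalerBl [X in _ - X]scalerl_alg.
rewrite [(q^-1 *: K + q *: Ki) *: v]scalerDl [(q^-1 *: K) *: v]scalerl_alg.
rewrite [(q *: Ki) *: v]scalerl_alg Kv Kiv !scaler_algA -!scalerDl.
by rewrite scaler_algA -!scalerBl.
Qed.

Lemma weight_FE v lam : v <> 0 -> K *: v = lam%:A *: v ->
  exists a : k, F *: (E *: v) = a%:A *: v.
Proof.
move=> v0 Kv; have [a EFv] := weight_EF v0 Kv; have Kiv := weight_Ki v0 Kv.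
exists (a - (q - q^-1)^-1 * (lam - lam^-1)).
rewrite scalerA uq_FE scalerBl -scalerA EFv [X in _ - X]scalerl_alg.
by rewrite [(K - Ki) *: v]scalerBl Kv Kiv -!scalerBl scaler_algA -!scalerBl.
Qed.

Hypothesis q_nonroot : forall n : nat, (0 < n)%N -> q ^+ n != 1.

Lemma exprz_eq1 (n : int) : q ^ n = 1 -> n = 0.
Proof.
case: n => [[//|n]|n] /eqP.
  by rewrite -exprnP (negPf (q_nonroot _)).
by rewrite NegzE -exprz_inv -exprnP exprVn invr_eq1 (negPf (q_nonroot _)).
Qed.

Lemma weights_inj lam : lam <> 0 -> injective (fun i : int => lam * q ^ (2 * i)).
Proof.
move=> /eqP lam0 i j /(mulfI lam0) qij.
have : q ^ (2 * i - 2 * j) = 1.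
  by rewrite expfzDr // qij -expfzDr // subrr.
rewrite -mulrBr => /exprz_eq1/eqP; rewrite mulf_eq0 /= => /eqP.
exact: subr0_eq.
Qed.

(** [Negz n] is [-(n + 1)], hence the [n.+1] applications of [F]. *)
Definition weight_chain v (i : int) : V :=
  match i with
  | Posz n => iter n (fun w => E *: w) v
  | Negz n => iter n.+1 (fun w => F *: w) v
  end.

Section WeightChain.
Variables (v : V) (lam : k).
Hypotheses (v0 : v <> 0) (Kv : K *: v = lam%:A *: v).
Hypothesis E_inj : forall (w : V) mu, w <> 0 -> K *: w = mu%:A *: w -> E *: w <> 0.
Hypothesis F_inj : forall (w : V) mu, w <> 0 -> K *: w = mu%:A *: w -> F *: w <> 0.
Local Notation vs := (weight_chain v).

(** Induction outwards from [v] in both directions: [E] and [F] multiply the weight by [q ^+ 2] and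
    [q ^- 2], and neither kills a weight vector. *)
Lemma weight_chainP i : vs i <> 0 /\ K *: vs i = (lam * q ^ (2 * i))%:A *: vs i.
Proof.
case: i => n; elim: n => [|n [IH0 IHK]].
- by split=> //=; rewrite mulr0 expr0z mulr1.
- split; first exact: E_inj IH0 IHK.
  rewrite [LHS](weight_E IHK) -mulrA; congr ((_ * _)%:A *: _).
  by rewrite (exprnP q 2) -expfzDr // [Posz n.+1]intS mulrDr addrC.
- split; first exact: F_inj v0 Kv.
  by rewrite [LHS](weight_F Kv).
- split; first exact: F_inj IH0 IHK.
  rewrite [LHS](weight_F IHK) -mulrA; congr ((_ * _)%:A *: _).
  by rewrite exprnN -expfzDr // !NegzE [Posz n.+2]intS opprD mulrDr addrC.
Qed.

(** At [i >= 0] this is the next step of the chain. At [i < 0], [E] undoes an [F] up to the scalar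
    of [weight_EF], which is nonzero by [E_inj] and [F_inj]. *)
Lemma weight_chainE i : exists2 a : k, a <> 0 & E *: vs i = a%:A *: vs (i + 1).
Proof.
have scal (w : V) mu : w <> 0 -> K *: w = mu%:A *: w ->
    exists2 a : k, a <> 0 & E *: (F *: w) = a%:A *: w.
  move=> w0 Kw; have [a EFw] := weight_EF w0 Kw; exists a => // a0.
  apply: (E_inj (F_inj w0 Kw) (weight_F Kw)).
  by rewrite EFw a0 scale0_alg.
case: i => [n|[|n]].
- exists 1; first exact/eqP/oner_neq0.
  by rewrite -PoszD addn1 scale1_alg.
- exact: scal v0 Kv.
- have -> : Negz n.+1 + 1 = Negz n.
    by rewrite !NegzE -[in LHS]addn1 PoszD opprD addrK.
  by have [wn0 Kwn] := weight_chainP (Negz n); exact: scal wn0 Kwn.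
Qed.

Lemma weight_chainF i : exists2 a : k, a <> 0 & F *: vs i = a%:A *: vs (i - 1).
Proof.
have scal (w : V) mu : w <> 0 -> K *: w = mu%:A *: w ->
    exists2 a : k, a <> 0 & F *: (E *: w) = a%:A *: w.
  move=> w0 Kw; have [a FEw] := weight_FE w0 Kw; exists a => // a0.
  apply: (F_inj (E_inj w0 Kw) (weight_E Kw)).
  by rewrite FEw a0 scale0_alg.
case: i => [[|n]|n].
- by exists 1; [exact/eqP/oner_neq0|rewrite scale1_alg].
- have -> : Posz n.+1 - 1 = Posz n by rewrite -addn1 PoszD addrK.
  by have [wn0 Kwn] := weight_chainP (Posz n); exact: scal wn0 Kwn.
- exists 1; first exact/eqP/oner_neq0.
  have -> : Negz n - 1 = Negz n.+1.
    by rewrite !NegzE -[in RHS]addn1 PoszD opprD.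
  by rewrite scale1_alg.
Qed.

Hypothesis indA : forall P : A -> Prop,
  P E -> P F -> P K -> P Ki -> P 1 ->
  (forall u u', P u -> P u' -> P (u * u')) ->
  (forall (a : k) u u', P u -> P u' -> P (a *: u + u')) ->
  forall u, P u.
Hypothesis simV : simple_module V.

(** The span of the chain is stable under the generators, so it is all of [V] by simplicity.
    Uniqueness holds because the weights are distinct, [q] not being a root of unity. *)
Lemma weight_chain_basis w : exists! a : {malg k[int]}, w = lincomb vs a.
Proof.
have lam0 := weight_neq0 v0 Kv.
pose W : {pred V} := fun w => `[< exists a, w = lincomb vs a >].
have W_comb (l : k) x y : x \in W -> y \in W -> l%:A *: x + y \in W.
  move=> /asboolP[a ->] /asboolP[b ->]; apply/asboolP; exists (l *: a + b).
  by rewrite lincombD lincombZ.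
have W0 : 0 \in W.
  by apply/asboolP; exists 0; rewrite /lincomb msupp0 big_seq_fset0.
have W_scale (l : k) i : l%:A *: vs i \in W.
  rewrite -[_ *: _]addr0; apply: W_comb => //.
  by apply/asboolP; exists (mkmalgU i 1); rewrite lincombU.
(* As scalars are central, stability of the span need only be checked on the chain itself. *)
have act_of_chain u : (forall i, u *: vs i \in W) -> {homo *:%R u : x / x \in W}.
  move=> uW _ /asboolP[a ->]; rewrite /lincomb scaler_sumr.
  by elim/big_rec: _ => // i x _ xW; rewrite scaler_algC; apply: W_comb.
have W_act u : {homo *:%R u : x / x \in W}.
  elim/indA: u => [||||x xW|u u' IHu IHu' x xW|l u u' IHu IHu' x xW].
  - by apply: act_of_chain => i; have [a _ ->] := weight_chainE i.
  - by apply: act_of_chain => i; have [a _ ->] := weight_chainF i.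
  - by apply: act_of_chain => i; rewrite (weight_chainP i).2.
  - apply: act_of_chain => i; have [vi0 Kvi] := weight_chainP i.
    by rewrite (weight_Ki vi0 Kvi).
  - by rewrite scale1r.
  - by rewrite -scalerA; apply/IHu/IHu'.
  - by rewrite scalerDl scalerl_alg; apply: W_comb; [apply: IHu|apply: IHu'].
have [|W_eq0|/(_ w)/asboolP[a wE]] := simV.2 W.
- split=> // u x y xW yW; rewrite -[_ *: x]scale1_alg.
  by apply: W_comb => //; exact: W_act.
- by case: v0; apply: W_eq0; have := W_scale 1 0; rewrite scale1_alg.
exists a; split=> // b wEb; apply/subr0_eq.
apply: (lincomb_eq0 (weights_inj lam0) (fun i => (weight_chainP i).1)
          (fun i => (weight_chainP i).2)).
have -> : a - b = a + (-1) *: b by rewrite scaleN1r.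
rewrite lincombD lincombZ -wE -wEb.
by rewrite !scaleN1r subrr.
Qed.

End WeightChain.
End UqModule.

(** * Right division in skew Laurent polynomial rings *)

Section SkewLaurentDivision.
Variables (L : fieldType) (s : ring_aut L).
Local Notation B := (skew_laurent s).
Local Notation term := (@sl_term L s).
Local Notation sigma := (aut_exp s).
Implicit Types (u v : B) (m n N : nat) (i j : int).

Lemma mcoeff_sl_termM (a : L) i u j : (term a i * u)@_j = a * sigma i u@_(j - i).
Proof.
have -> : (term a i * u) = \sum_(l <- msupp u) term (a * sigma i u@_l) (i + l).
  rewrite {1}[u](@sl_sum L s) mulr_sumr.
  by apply: eq_bigr => l _; rewrite [LHS]sl_termM.
rewrite raddf_sum /=.
have [sj|sj] := boolP (j - i \in msupp u); last first.
  rewrite (mcoeff_outdom sj) rmorph0 mulr0 big1_seq // => l /andP[_ sl].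
  rewrite mcoeffU; case: eqP => // e; case/negP: sj.
  by rewrite -e addrC addKr.
rewrite (big_fsetD1 (j - i)) //= big1_seq ?addr0 => [|l].
  by rewrite mcoeffU [i + _]addrC subrK eqxx.
rewrite !inE => /andP[_ /andP[/eqP lj _]].
by rewrite mcoeffU; case: eqP => // e; case: lj; rewrite -e addrC addKr.
Qed.

Lemma mcoeff_slM u v j :
  (u * v)@_j = \sum_(i <- msupp u) u@_i * sigma i v@_(j - i).
Proof.
rewrite {1}[u](@sl_sum L s) mulr_suml raddf_sum.
by apply: eq_bigr => i _; rewrite [LHS]mcoeff_sl_termM.
Qed.

Lemma sl_constM (a b : L) i : term a 0 * term b i = term (a * b) i.
Proof. by rewrite [LHS]sl_termM add0r. Qed.

Lemma sl_const_inv (a : L) : a != 0 ->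
  term a 0 * term a^-1 0 = 1 /\ term a^-1 0 * term a 0 = 1.
Proof. by move=> a0; rewrite !sl_constM mulfV // mulVf. Qed.

Lemma mcoeff_slM_const u (a : L) j : (u * term a 0)@_j = u@_j * sigma j a.
Proof.
have -> : u * term a 0 = \sum_(i <- msupp u) term (u@_i * sigma i a) i.
  rewrite {1}[u](@sl_sum _ s) mulr_suml; apply: eq_bigr => i _.
  by rewrite [LHS]sl_termM addr0.
rewrite raddf_sum /=; have [ju|ju] := boolP (j \in msupp u).
  rewrite (big_fsetD1 j) //= big1_seq ?addr0 => [|i].
    by rewrite mcoeffU eqxx.
  by rewrite !inE => /andP[_ /andP[/negPf ij _]]; rewrite mcoeffU ij.
rewrite (mcoeff_outdom ju) mul0r big1_seq // => i /andP[_ iu].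
by rewrite mcoeffU; case: eqP ju => // <-; rewrite iu.
Qed.

(** These are the polynomials in [y] of degree below [n], among which leading terms and right
    division make sense. *)
Definition supp_lt n u : Prop := forall j, u@_j != 0 -> (0 <= j < n%:Z).

Lemma supp_lt_out n u j : supp_lt n u -> ~~ (0 <= j < n%:Z) -> u@_j = 0.
Proof. by move=> un jn; apply/eqP; apply: contraNT jn; apply: un. Qed.

Lemma supp_ltW m n u : (m <= n)%N -> supp_lt m u -> supp_lt n u.
Proof. by move=> mn um j /um; lia. Qed.

Lemma supp_ltD n u v : supp_lt n u -> supp_lt n v -> supp_lt n (u + v).
Proof.
move=> un vn j; apply: contraNT => jn.
by rewrite mcoeffD (supp_lt_out un) // (supp_lt_out vn) // addr0.
Qed.

Lemma supp_lt_eq0 u : supp_lt 0 u -> u = 0.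
Proof.
move=> u0; apply/malgP => j; rewrite mcoeff0 (supp_lt_out u0) //; lia.
Qed.

Lemma supp_lt_top n u : supp_lt n u -> u != 0 ->
  exists m, [/\ (m < n)%N, supp_lt m.+1 u & u@_m%:Z != 0].
Proof.
elim: n => [|n IH] un u0; first by rewrite (supp_lt_eq0 un) eqxx in u0.
have [un0|un0] := eqVneq (u@_n%:Z) 0; last by exists n.
have [|//|m [mn um um0]] := IH; last by exists m; split=> //; lia.
move=> j uj; have := un _ uj; suff : j != n%:Z by lia.
by apply: contraNneq uj => ->; rewrite un0.
Qed.

Lemma shift_mcoeff N u j : (term 1 N * u)@_j = sigma N u@_(j - N%:Z).
Proof. by rewrite mcoeff_sl_termM mul1r. Qed.

Lemma supp_lt_shift u : exists N n, supp_lt n (term 1 N * u).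
Proof.
(* This sum bounds every [|j|] in the support, so the exponents between [-N] and [N] are moved to 0,
   ..., [N + N]. *)
pose N := (\sum_(j <- msupp u) `|j|)%N.
exists N, (N + N).+1 => j; rewrite shift_mcoeff => uj.
have {uj} : j - N%:Z \in msupp u.
  by rewrite -mcoeff_neq0; apply: contraNneq uj => ->; rewrite rmorph0.
have NP i : i \in msupp u -> (`|i| <= N)%N.
  by move=> si; rewrite /N (big_fsetD1 i) //= leq_addr.
by move=> /NP; lia.
Qed.

Lemma supp_lt_constM n (a : L) u : supp_lt n u -> supp_lt n (term a 0 * u).
Proof.
move=> un j; rewrite mcoeff_sl_termM subr0 => auj; apply: un.
by apply: contraNneq auj => ->; rewrite mulr0.
Qed.

(** An index [i < m] would need a coefficient of [v] of degree above [n], so only the leading terms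
    contribute. *)
Lemma mcoeff_slM_top m n u v : supp_lt m.+1 u -> supp_lt n.+1 v ->
  (u * v)@_(m + n)%N%:Z = u@_m%:Z * sigma m v@_n%:Z.
Proof.
move=> um vn; rewrite mcoeff_slM.
have [sm|sm] := boolP (m%:Z \in msupp u); last first.
  rewrite (mcoeff_outdom sm) mul0r big1_seq // => i /andP[_ si].
  rewrite (supp_lt_out vn) ?rmorph0 ?mulr0 //.
  have : i != m%:Z by apply: contraNneq sm => <-.
  by move: si; rewrite -mcoeff_neq0 => /um; lia.
rewrite (big_fsetD1 m%:Z) //= big1_seq ?addr0 => [|i].
  by rewrite PoszD addrC addKr.
rewrite !inE => /andP[_ /andP[im si]].
rewrite (supp_lt_out vn) ?rmorph0 ?mulr0 //.
by move: si; rewrite -mcoeff_neq0 => /um; lia.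
Qed.

Lemma sl_shiftK N : term 1 (- N%:Z) * term 1 N = 1.
Proof. by rewrite [LHS]sl_termM rmorph1 mulr1 addNr. Qed.

Lemma sl_shift_eq0 N u : term 1 N * u = 0 -> u = 0.
Proof. by move=> e; rewrite -[u]mul1r -(sl_shiftK N) -mulrA e mulr0. Qed.

(** After both factors are shifted to polynomials in [y], the product of their leading coefficients,
    one of them twisted, is nonzero. *)
Lemma sl_mul_eq0 u v : u * v = 0 -> v <> 0 -> u = 0.
Proof.
move=> uv0 /eqP v0; have [N [n vn]] := supp_lt_shift v.
(* The factor [y^-N] on the right of [u] cancels the [y^N] put on the left of [v]. *)
pose u' := u * term 1 (- N%:Z); have [M [m um]] := supp_lt_shift u'.
have uv : term 1 M * u' * (term 1 N * v) = 0.
  rewrite -mulrA /u' -[u * _ * _]mulrA [_ * (term 1 N * v)]mulrA.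
  by rewrite sl_shiftK mul1r uv0 mulr0.
have {um} : term 1 M * u' = 0.
  apply/eqP/negPn/negP => u0.
  have v1 : term 1 N * v != 0 by apply: contraNneq v0 => /sl_shift_eq0 ->.
  have [m' [_ um' u'm]] := supp_lt_top um u0.
  have [n' [_ vn' v'n]] := supp_lt_top vn v1.
  have := mcoeff_slM_top um' vn'; rewrite uv mcoeff0 => /esym/eqP.
  by rewrite mulf_eq0 fmorph_eq0 (negPf u'm) (negPf v'n).
move=> /sl_shift_eq0 u'0.
by rewrite -[u]mulr1 -(sl_shiftK N) mulrA -/u' u'0 mul0r.
Qed.

(** In a ring without zero divisors, [(v * u - 1) * v = 0] forces [v * u = 1]. *)
Lemma sl_left_inverse u v : u * v = 1 -> v * u = 1.
Proof.
move=> uv; apply/subr0_eq; apply: (@sl_mul_eq0 _ v).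
  by rewrite mulrBl -mulrA uv mulr1 mul1r subrr.
move=> v0; move/eqP: uv; rewrite v0 mulr0 eq_sym; exact/negP/oner_neq0.
Qed.

(** Long division, by induction on the degree bound of the dividend. *)
Lemma sl_right_division m v : supp_lt m.+1 v -> v@_m%:Z != 0 ->
  forall n u, supp_lt n u ->
  exists d r, [/\ u = d * v + r, supp_lt n d & supp_lt m r].
Proof.
move=> vm v0; elim=> [|n IH] u un.
  exists 0, 0; rewrite (supp_lt_eq0 un) mul0r addr0; split=> // j;
  by rewrite mcoeff0 eqxx.
have [nm|mn] := ltnP n m.
  exists 0, u; rewrite mul0r add0r; split=> //; last exact: supp_ltW un.
  by move=> j; rewrite mcoeff0 eqxx.
(* Moving [y^(n-m)] past the leading coefficient of [v] twists it; dividing by the twisted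
   coefficient makes the terms of degree [n] cancel. *)
pose a := u@_n%:Z / sigma (n - m)%N v@_m%:Z.
have [|d [r [uE dn rm]]] := IH (u - term a (n - m)%N * v).
  move=> j; rewrite mcoeffB mcoeff_sl_termM.
  have [->|jn] := eqVneq j n%:Z.
    have -> : n%:Z - (n - m)%N%:Z = m by lia.
    by rewrite divfK ?fmorph_eq0 // subrr eqxx.
  apply: contraNT => jn'; rewrite (supp_lt_out un); last lia.
  by rewrite (supp_lt_out vm) ?rmorph0 ?mulr0 ?subrr //; lia.
exists (d + term a (n - m)%N), r; split=> //.
  by rewrite mulrDl addrAC -uE subrK.
apply: supp_ltD; first exact: supp_ltW dn.
move=> j; rewrite mcoeffU; case: (_ =P j) => [<- _|]; last by rewrite eqxx.
by lia.
Qed.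

End SkewLaurentDivision.

(** * Torsion-free modules *)

Section TorsionFree.
Variables (k : fieldType) (q c : k) (A : algType k) (E F K Ki : A).
Hypothesis relA : {in uq_rels q E F K Ki, forall u, u = 0}.
Hypothesis casA : casimir q E F K Ki = c%:A.
Hypothesis q0 : q != 0.
Hypothesis indA : forall P : A -> Prop,
  P E -> P F -> P K -> P Ki -> P 1 ->
  (forall u u', P u -> P u' -> P (u * u')) ->
  (forall (a : k) u u', P u -> P u' -> P (a *: u + u')) ->
  forall u, P u.

(** * Normal ordering in K and F *)

Local Notation hK := (horner_alg K).

(** The normally ordered sum of the [p_i(K) F^i]: evaluation keeps the coefficients to the left of
    the powers of [F]. *)
Definition pol_KF (p : {poly {poly k}}) : A := (map_poly hK p).[F].

Lemma pol_KFD p r : pol_KF (p + r) = pol_KF p + pol_KF r.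
Proof. by rewrite /pol_KF rmorphD hornerD. Qed.

Lemma pol_KFCM f p : pol_KF (f%:P * p) = hK f * pol_KF p.
Proof. by rewrite /pol_KF rmorphM /= map_polyC hornerCM. Qed.

Lemma pol_KFMX p : pol_KF (p * 'X) = pol_KF p * F.
Proof. by rewrite /pol_KF rmorphM /= map_polyX hornerMX. Qed.

Lemma pol_KFC f : pol_KF f%:P = hK f.
Proof. by rewrite /pol_KF map_polyC hornerC. Qed.

Lemma uq_FK : F * K = q ^+ 2 *: (K * F).
Proof. by rewrite (uq_KF relA) scalerA mulfV ?expf_neq0 // scale1r. Qed.

Lemma uq_FKi : F * Ki = q ^- 2 *: (Ki * F).
Proof.
have [KKi KiK _ _ _] := uq_relsP relA.
rewrite -[F * Ki]mul1r -KiK -!mulrA [K * (F * Ki)]mulrA (uq_KF relA).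
by rewrite -scalerAl -scalerAr -mulrA KKi mulr1.
Qed.

(** The rule for moving [y] past [f(x)] in [B] holds in [A] already, by [uq_FK]. *)
Lemma F_horner_K f : F * hK f = hK (dil_poly (q ^+ 2) f) * F.
Proof.
elim/poly_ind: f => [|f a IH]; first by rewrite !rmorph0 mulr0 mul0r.
rewrite /dil_poly comp_polyD comp_polyM comp_polyX comp_polyC !rmorphD !rmorphM /=.
rewrite linearZ /= horner_algX !horner_algC mulrDr mulrDl mulr_algC; congr (_ + _).
rewrite [LHS]mulrA IH -[LHS]mulrA uq_FK ?mulr_algl -!scalerAr -!scalerAl.
by rewrite [in LHS]mulrA.
Qed.

Lemma F_pol_KF p : exists r, F * pol_KF p = pol_KF r.
Proof.
elim/poly_ind: p => [|p f [r IH]].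
  by exists 0; rewrite /pol_KF rmorph0 horner0 mulr0.
exists ((r + (dil_poly (q ^+ 2) f)%:P) * 'X).
by rewrite pol_KFMX !pol_KFD pol_KFMX !pol_KFC mulrDr mulrA IH F_horner_K -mulrDl.
Qed.

(** [K ^+ m] is there to absorb powers of [Ki], and [F ^+ N] to absorb factors [E], since [F * E] is
    a combination of 1, [K] and [Ki]. *)
Definition KF_cleared N m (u : A) := exists p, K ^+ m * F ^+ N * u = pol_KF p.

Lemma KF_clearedK N m u : KF_cleared N m u -> KF_cleared N m.+1 u.
Proof.
move=> [p up]; exists ('X%:P * p).
by rewrite pol_KFCM horner_algX -up exprS !mulrA.
Qed.

(** The scalar is [a ^+ (n * m)]; only its nonvanishing is recorded. *)
Lemma F_exp_qcomm (X : A) (a : k) n m :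
  F * X = a *: (X * F) ->
  exists b, F ^+ n * X ^+ m = b *: (X ^+ m * F ^+ n) /\ (a != 0 -> b != 0).
Proof.
move=> FX.
have [b [FXm b0]] : exists b, F * X ^+ m = b *: (X ^+ m * F) /\ (a != 0 -> b != 0).
  elim: m => [|m [b [IH b0]]].
    by exists 1; rewrite mulr1 mul1r scale1r oner_neq0.
  exists (a * b); rewrite exprS [LHS]mulrA FX -scalerAl -[X in a *: X]mulrA IH.
  rewrite -scalerAr scalerA mulrA.
  by split=> // a0; rewrite mulf_neq0 // b0.
elim: n => [|n [d [IH d0]]].
  by exists 1; rewrite mulr1 mul1r scale1r oner_neq0.
exists (b * d); rewrite exprS -[LHS]mulrA IH -scalerAr [in LHS]mulrA FXm.
rewrite -scalerAl scalerA mulrC mulrA.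
by split=> // a0; rewrite mulf_neq0 ?d0 ?b0.
Qed.

Lemma KF_clearedZ N m a u : KF_cleared N m u -> KF_cleared N m (a *: u).
Proof.
move=> [p up]; exists (a%:P%:P * p).
by rewrite pol_KFCM horner_algC -scalerAr up mulr_algl.
Qed.

Lemma KF_clearedF N m u : KF_cleared N m u -> KF_cleared N.+1 m u.
Proof.
move=> [p up]; have [b [FK b0]] := F_exp_qcomm 1 m uq_FK.
have [r pr] := F_pol_KF p; exists (b^-1%:P%:P * r).
rewrite pol_KFCM horner_algC -pr -up mulr_algl !mulrA FK -!scalerAl scalerA.
by rewrite mulVf ?b0 ?expf_neq0 // scale1r exprS !mulrA.
Qed.

(** Two elements can thus be cleared by a common [K ^+ m * F ^+ N] before they are added. *)
Lemma KF_clearedW N m N' m' u :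
  KF_cleared N m u -> KF_cleared (N' + N) (m' + m) u.
Proof.
move=> um; elim: N' => [|N' IH]; last exact: KF_clearedF.
by elim: m' => [|m' IH] //; exact: KF_clearedK.
Qed.

Definition KF_clearable u := exists N m, KF_cleared N m u.

Lemma KF_clearable_lin a u u' :
  KF_clearable u -> KF_clearable u' -> KF_clearable (a *: u + u').
Proof.
move=> [N [m um]] [N' [m' um']]; exists (N' + N)%N, (m' + m)%N.
have [p up] := KF_clearedZ a (KF_clearedW N' m' um).
have := KF_clearedW N m um'; rewrite (addnC N) (addnC m) => -[p' up'].
by exists (p + p'); rewrite pol_KFD mulrDr up up'.
Qed.

Lemma KF_clearable_K u : KF_clearable u -> KF_clearable (K * u).
Proof.
move=> [N [m [p up]]]; exists N, m.
have [b [FK _]] := F_exp_qcomm N 1 uq_FK.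
exists ((b *: 'X)%:P * p); rewrite pol_KFCM linearZ /= horner_algX -up.
rewrite !mulrA -[K ^+ m * _ * K]mulrA FK -scalerAr -!scalerAl !mulrA.
by rewrite expr1 mul1r -exprSr exprS.
Qed.

Lemma KF_clearable_Ki u : KF_clearable u -> KF_clearable (Ki * u).
Proof.
have [KKi _ _ _ _] := uq_relsP relA.
move=> [N [m um]]; have [b [FKi _]] := F_exp_qcomm N 1 uq_FKi.
exists N, m.+1; have [p up] := KF_clearedZ b um; exists p; rewrite -up.
rewrite !mulrA -[K ^+ m.+1 * _ * Ki]mulrA FKi -!scalerAr -!scalerAl exprSr !mulrA.
by rewrite -[K ^+ m * K * Ki]mulrA KKi mulr1.
Qed.

Lemma KF_clearable_divF u : KF_clearable (F * u) -> KF_clearable u.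
Proof.
by move=> [N [m [p up]]]; exists N.+1, m, p; rewrite -up exprSr !mulrA.
Qed.

Lemma KF_clearable_all u : KF_clearable u.
Proof.
(* Stability under left multiplication by [u] is what passes through products in the induction. *)
suff : forall u', KF_clearable u' -> KF_clearable (u * u').
  move/(_ 1); rewrite mulr1; apply; exists 0%N, 0%N, 1.
  by rewrite /pol_KF rmorph1 hornerC !mulr1.
elim/indA: u =>
  [u' cu'|u' [N [m um]]| | |u'|u1 u2 IH1 IH2 u' cu'|a u1 u2 IH1 IH2 u' cu'].
(* For [E], multiply by one more [F]: [F * E] involves only 1, [K] and [Ki], whose cases are
   known. *)
- apply: KF_clearable_divF; rewrite mulrA (uq_FE relA) (uq_EF casA).
  have K_ := KF_clearable_K cu'; have Ki_ := KF_clearable_Ki cu'.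
  have addC x y : KF_clearable x -> KF_clearable y -> KF_clearable (x + y).
    by rewrite -{2}[x]scale1r; exact: KF_clearable_lin.
  have scaleC l x : KF_clearable x -> KF_clearable (l *: x).
    by move=> [N [m xm]]; exists N, m; exact: KF_clearedZ.
  rewrite !mulrBl -!scalerAl mul1r mulrDl mulrBl -!scalerAl -!scaleNr.
  rewrite -[- (Ki * _)]scaleN1r.
  exact: (addC _ _ (addC _ _ (scaleC _ _ cu')
      (scaleC _ _ (addC _ _ (scaleC _ _ K_) (scaleC _ _ Ki_))))
    (scaleC _ _ (addC _ _ K_ (scaleC _ _ Ki_)))).
- have [p up] := KF_clearedF um; exists N, m, p.
  by rewrite -up exprSr !mulrA.
- exact: KF_clearable_K.
- exact: KF_clearable_Ki.
- by rewrite mul1r.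
- by rewrite -mulrA; apply/IH1/IH2.
- by rewrite mulrDl -scalerAl; apply: KF_clearable_lin; [apply: IH1|apply: IH2].
Qed.

(* [L], [frac] and [s] stand for k(x), k[x] -> k(x) and f(x) |-> f(q^2 x). *)
Variables (L : fieldType) (frac : {rmorphism {poly k} -> L}) (s : ring_aut L).
Local Notation "f %:F" := (frac f).
Hypothesis frac_inj : injective frac.
Hypothesis fracP : forall z : L, exists a b, b != 0 /\ z = a%:F / b%:F.
Hypothesis s_frac : forall f, s f%:F = (dil_poly (q ^+ 2) f)%:F.
Local Notation B := (skew_laurent s).
Local Notation term := (@sl_term _ s).
Variable psi : {rmorphism A -> B}.
Hypothesis psi_alg : forall a : k, psi a%:A = term a%:P%:F 0.
Hypothesis psi_K : psi K = term 'X%:F 0.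
Hypothesis psi_F : psi F = term 1 1.

(** * The image of the algebra in the skew Laurent ring *)

Lemma frac_eq0 f : (f%:F == 0) = (f == 0).
Proof. by rewrite -(rmorph0 frac) (inj_eq frac_inj). Qed.

Lemma psi_horner_K f : psi (hK f) = term f%:F 0.
Proof.
elim/poly_ind: f => [|f a IH]; first by rewrite !rmorph0 [RHS]sl_term0.
rewrite !rmorphD !rmorphM /= horner_algX horner_algC psi_alg psi_K IH.
by rewrite [RHS]sl_termD [X in X + _]sl_termM addr0.
Qed.

Lemma psi_FX n : psi (F ^+ n) = term 1 n.
Proof.
elim: n => [|n IH]; first by rewrite rmorph1.
rewrite exprSr rmorphM /= IH psi_F [LHS]sl_termM rmorph1 mulr1.
by rewrite -PoszD addn1.
Qed.

Lemma psi_pol_KF p : psi (pol_KF p) = \sum_(i < size p) term (p`_i)%:F i.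
Proof.
rewrite /pol_KF (horner_coef_wide _ (size_poly _ _)) rmorph_sum.
apply: eq_bigr => i _; rewrite rmorphM /= psi_FX coef_map psi_horner_K.
by rewrite [LHS]sl_termM rmorph1 mulr1 add0r.
Qed.

Lemma mcoeff_psi_pol_KF p (n : nat) : (psi (pol_KF p))@_(n%:Z) = (p`_n)%:F.
Proof.
rewrite psi_pol_KF raddf_sum /=.
have [np|pn] := ltnP n (size p); last first.
  rewrite nth_default // rmorph0 big1 // => i _; rewrite mcoeffU.
  by case: (_ =P n%:Z) => // -[ni]; have := ltn_ord i; rewrite ni ltnNge pn.
rewrite (bigD1 (Ordinal np)) //= big1 ?addr0 => [|i /eqP ni].
  by rewrite mcoeffU eqxx.
by rewrite mcoeffU; case: (_ =P n%:Z) => // -[e]; case: ni; apply: val_inj.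
Qed.

(** The coefficients of [p] can be read off in [B], so [psi] is injective on normally ordered
    elements. *)
Lemma psi_pol_KF_eq0 p : psi (pol_KF p) = 0 -> pol_KF p = 0.
Proof.
move=> p0; suff -> : p = 0 by rewrite /pol_KF rmorph0 horner0.
apply/polyP => n; apply/eqP; rewrite coef0 -frac_eq0 -mcoeff_psi_pol_KF p0.
by rewrite mcoeff0.
Qed.

Lemma clear_denominators (d : B) n : supp_lt n d ->
  exists f w, f != 0 /\ term f%:F 0 * d = psi w.
Proof.
move=> dn; rewrite [d](@sl_sum _ s) big_seq_cond.
elim/big_rec: _ => [|i u]; first by exists 1, 0; rewrite oner_neq0 mulr0 rmorph0.
rewrite andbT -mcoeff_neq0 => /dn i_ge0 [g [w [g0 gw]]].
have [m -> {i_ge0}] : exists m : nat, i = m by case: i i_ge0 => // m; exists m.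
have [a [b [b0 ab]]] := fracP d@_m%:Z.
(* With [g] a denominator for the other terms, [g * b] turns the new term [(a/b) y^m] into [g a y^m]
   and the other terms into [b] times the image of [w]. *)
exists (g * b), (hK (g * a) * F ^+ m + hK b * w); split; first by rewrite mulf_neq0.
rewrite mulrDr !rmorphD !rmorphM /= !psi_horner_K psi_FX -gw ab; congr (_ + _).
  rewrite !sl_constM mulr1; congr term.
  by rewrite -mulrA [b%:F * _]mulrC divfK ?frac_eq0.
by rewrite [RHS]mulrA sl_constM mulrC.
Qed.

(** * The annihilator of a vector in a torsion-free simple module *)

Hypothesis q21 : q ^+ 2 != 1.
Variable V : lmodType A.
Hypothesis simV : simple_module V.
Hypothesis torsionfree : forall (f : {poly k}) (v : V),
  f != 0 -> hK f *: v = 0 -> v = 0.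
Implicit Types (v : V).

Lemma torsionfree_K v : K *: v = 0 -> v = 0.
Proof. by rewrite -(horner_algX K); apply/torsionfree; rewrite polyX_eq0. Qed.

(** [K * (E * F)] is a polynomial [f] in [K], and it kills [v] as soon as [F] does. *)
Lemma torsionfree_F v : F *: v = 0 -> v = 0.
Proof.
have [KKi _ _ _ _] := uq_relsP relA.
move=> Fv0; pose w := (q - q^-1) ^- 2.
pose f : {poly k} := c *: 'X - w *: (q^-1 *: ('X * 'X) + q%:P).
apply: (@torsionfree f).
  have w0 : w != 0.
    rewrite invr_eq0 expf_neq0 // subr_eq0; apply: contra q21 => /eqP qV.
    by rewrite expr2 {1}qV mulVf.
  (* The constant term of [f] is [- w * q]. *)
  apply/eqP => /(congr1 (horner^~ 0))/eqP.
  rewrite /f !hornerE /= !(mulr0, mul0r) add0r oppr_eq0.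
  by rewrite mulf_eq0 (negPf w0) (negPf q0).
have -> : hK f = K * (E * F).
  have -> : hK f = c *: K - w *: (q^-1 *: (K * K) + q%:A).
    rewrite /f linearB !linearZ /= linearD linearZ /= rmorphM /=.
    by rewrite horner_algX horner_algC !mulr_algl scalerN.
  rewrite (uq_EF casA) -/w mulrBr mulr_algr -scalerAr mulrDr.
  by rewrite -!scalerAr KKi.
by rewrite -!scalerA Fv0 !scaler0.
Qed.

Lemma torsionfree_KF N m v : (K ^+ m * F ^+ N) *: v = 0 -> v = 0.
Proof.
rewrite -scalerA; elim: m => [|m IH].
  rewrite scale1r; elim: N => [|N IH]; first by rewrite scale1r.
  by rewrite exprS -scalerA => /torsionfree_F.
by rewrite exprS -scalerA => /torsionfree_K.
Qed.

(** Some [K ^+ m * F ^+ N * u] is normally ordered and hence zero, while [K] and [F] act injectively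
    on [V]. *)
Lemma psi_ker u v : psi u = 0 -> u *: v = 0.
Proof.
move=> u0; have [N [m [p up]]] := KF_clearable_all u.
apply: (@torsionfree_KF N m); rewrite scalerA up psi_pol_KF_eq0 ?scale0r //.
by rewrite -up rmorphM u0 mulr0.
Qed.

Lemma aut_exp_polyX (n : nat) (a b : k) :
  aut_exp s n (a *: 'X + b%:P)%:F = ((a * (q ^+ 2) ^+ n) *: 'X + b%:P)%:F.
Proof.
elim: n => [|n IH]; first by rewrite expr0 mulr1.
rewrite /= -/(aut_exp s n) in IH *; rewrite IH s_frac /dil_poly.
rewrite comp_polyD comp_polyZ comp_polyX comp_polyC scalerA.
by rewrite (exprSr (q ^+ 2)) mulrA.
Qed.

(** Otherwise simplicity would provide a left inverse of [x - 1] within the image of [psi], where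
    there is none. *)
Lemma annihilator_neq0 v : v <> 0 -> exists u, u *: v = 0 /\ psi u <> 0.
Proof.
move=> v0; apply: contrapT => noU.
pose g : {poly k} := 1 *: 'X + (-1)%:P.
have gv : hK g *: v <> 0.
  move=> /torsionfree gv; apply: v0; apply: gv; apply/eqP => /(congr1 (coefp 1)).
  rewrite /= coefD coefZ coefX coefC coef0 mulr1 addr0; exact/eqP/oner_neq0.
have [u uv] := simple_module_generated simV gv v.
have : psi (1 - u * hK g) = 0.
  apply: contrapT => ne; apply: noU; exists (1 - u * hK g); split=> //.
  by rewrite scalerBl scale1r -scalerA -uv subrr.
rewrite rmorphB rmorph1 rmorphM /= psi_horner_K => /eqP.
rewrite subr_eq0 eq_sym => /eqP ug.
have [N [m [p up]]] := KF_clearable_all u.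
have : psi (pol_KF p) * term g%:F 0 = psi (hK ('X^m) * F ^+ N).
  by rewrite -up rmorphM -mulrA ug mulr1 rmorphXn /= horner_algX.
(* Comparing coefficients of [y^N] gives [p_N(x) g(q^(2N) x) = x^m] in [k[x]]. *)
move=> /(congr1 (fun b : B => b@_(N%:Z))).
rewrite [LHS]mcoeff_slM_const mcoeff_psi_pol_KF aut_exp_polyX mul1r.
rewrite rmorphM /= psi_horner_K psi_FX [X in _ = X@__]sl_termM.
rewrite mcoeffU rmorph1 mulr1.
rewrite add0r eqxx mulr1n -rmorphM => /frac_inj.
(* At [x = q^(-2N)] the left side vanishes, as [g] is ['X - 1], and the right side does not. *)
move=> /(congr1 (horner^~ ((q ^+ 2) ^- N)))/eqP; rewrite /= !hornerE.
rewrite mulfV ?expf_neq0 ?expf_neq0 // subrr mulr0 eq_sym; apply/negP.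
by rewrite expf_neq0 // invr_eq0 !expf_neq0.
Qed.

(** Elements of [B] are left fractions over the image of [psi], with denominators [f(x) y^N]. *)
Lemma clear_fraction (b : B) :
  exists N (f : {poly k}) w, f != 0 /\ term f%:F 0 * (term 1 N%:Z * b) = psi w.
Proof.
have [N [n bn]] := supp_lt_shift b.
by have [f [w fw]] := clear_denominators bn; exists N, f, w.
Qed.

Lemma clear_fraction_inv N (f : {poly k}) (b : B) : f != 0 ->
  b = term 1 (- N%:Z) * term (f%:F)^-1 0 * (term f%:F 0 * (term 1 N%:Z * b)).
Proof.
move=> f0; have f1 : f%:F != 0 by rewrite frac_eq0.
have [_ ff] := sl_const_inv s f1.
rewrite -mulrA [term _^-1 0 * _]mulrA ff mul1r mulrA.
by rewrite sl_shiftK mul1r.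
Qed.

(** Multiplying an annihilating element by a power of [F] makes its image a polynomial in [y], so a
    least degree [m] exists. *)
Lemma annihilator_min v : v <> 0 -> exists u0 (m : nat),
  [/\ u0 *: v = 0, supp_lt m.+1 (psi u0), (psi u0)@_(m%:Z) != 0 &
      forall u, u *: v = 0 -> supp_lt m (psi u) -> psi u = 0].
Proof.
move=> v0; pose P n :=
  `[< exists u, [/\ u *: v = 0, psi u <> 0 & supp_lt n (psi u)] >].
have exP : exists n, P n.
  have [u [uv u0]] := annihilator_neq0 v0.
  have [N [n un]] := supp_lt_shift (psi u).
  exists n; apply/asboolP; exists (F ^+ N * u); split.
  - by rewrite -scalerA uv scaler0.
  - by rewrite rmorphM /= psi_FX => /sl_shift_eq0.
  - by rewrite rmorphM /= psi_FX.
case: (ex_minnP exP) => n /asboolP[u0 [u0v /eqP u00 u0n]] n_min.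
have [m [mn u0m top]] := supp_lt_top u0n u00.
exists u0, m; split=> // u uv um; apply: contrapT => u_neq0.
by have /n_min : P m by [apply/asboolP; exists u]; rewrite leqNgt mn.
Qed.

Lemma annihilator_principal v : v <> 0 -> exists u0,
  psi u0 <> 0 /\ forall u, u *: v = 0 <-> exists b, psi u = b * psi u0.
Proof.
move=> v0; have [u0 [m [u0v u0m top u0_min]]] := annihilator_min v0.
exists u0; split; first by move=> u00; rewrite u00 mcoeff0 eqxx in top.
move=> u; split=> [uv|[b ub]]; last first.
  (* Once [b] is cleared, [f(K) F^N u] and [w u0] have the same image, so [f(K) F^N] kills [u *: v],
     and torsion-freeness applies. *)
  have [N [f [w [f0 fw]]]] := clear_fraction b.
  have : psi (hK f * (F ^+ N * u) - w * u0) = 0.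
    rewrite rmorphB !rmorphM /= psi_horner_K psi_FX -fw ub.
    by rewrite -!mulrA subrr.
  move=> /(@psi_ker _ v); rewrite scalerBl -(scalerA w) u0v scaler0 subr0.
  rewrite -scalerA => /(torsionfree f0); rewrite -scalerA -[F ^+ N]mul1r.
  exact: (@torsionfree_KF N 0).
(* Conversely, divide [y^N psi u] by [psi u0]. Up to a factor [f(x)], the remainder is the image of
   an annihilating element of degree below [m], so it is zero. *)
have [N [n un]] := supp_lt_shift (psi u).
have [d [r [uE dn rm]]] := sl_right_division u0m top un.
have [f [w [f0 fw]]] := clear_denominators dn.
have psir : psi (hK f * (F ^+ N * u) - w * u0) = term f%:F 0 * r.
  rewrite rmorphB !rmorphM /= psi_horner_K psi_FX -fw [term 1 _ * _]uE mulrDr.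
  by rewrite mulrA addrAC subrr add0r.
have r0 : term f%:F 0 * r = 0.
  rewrite -psir; apply: u0_min; last by rewrite psir; exact: supp_lt_constM.
  by rewrite scalerBl -!scalerA u0v uv !scaler0 subrr.
have {}r0 : r = 0.
  have f1 : f%:F != 0 by rewrite frac_eq0.
  by have [_ ff] := sl_const_inv s f1; rewrite -[r]mul1r -ff -mulrA r0 mulr0.
exists (term 1 (- N%:Z) * d).
by rewrite -mulrA -[d * _]addr0 -r0 -uE mulrA sl_shiftK mul1r.
Qed.

(** If [psi u0 = b * c'], the [u] with image in [B c'] form a left ideal containing the annihilator
    of [v]. If the two agree, [b] is a unit; if not, simplicity of [V] makes [c'] a unit. *)
Lemma annihilator_irreducible v u0 : v <> 0 -> psi u0 <> 0 ->
  (forall u, u *: v = 0 <-> exists b, psi u = b * psi u0) ->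
  irreducible_elt (psi u0).
Proof.
move=> v0 u00 annP; split=> // [[b [_ bu0]]|b c' u0E].
  case: v0; rewrite -[v]scale1r; apply/annP; exists b.
  by rewrite rmorph1 bu0.
have [allI|/existsNP[u /not_implyP[[x ux] uv]]] :=
    EM (forall u, (exists x, psi u = x * c') -> u *: v = 0).
  left; have [N [f [w [f0 fw]]]] := clear_fraction c'.
  have /allI/annP[d wd] : exists x, psi w = x * c'.
    by exists (term f%:F 0 * term 1 N%:Z); rewrite -fw mulrA.
  have cE := clear_fraction_inv N c' f0; rewrite fw wd u0E in cE.
  (* Undoing the clearing of [c'] gives [c' = t * b * c'], and [c'] can be cancelled. *)
  pose t := term 1 (- N%:Z) * term (f%:F)^-1 0 * d.
  have tb : t * b = 1.
    apply/subr0_eq; apply: (@sl_mul_eq0 _ s _ c').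
      by rewrite mulrBl mul1r /t -!mulrA {2}cE -!mulrA subrr.
    by move=> c0; apply: u00; rewrite u0E c0 mulr0.
  by exists t; split=> //; exact: (@sl_left_inverse _ s).
right; have [u' vE] := simple_module_generated simV uv v.
have /annP[d dE] : (1 - u' * u) *: v = 0.
  by rewrite scalerBl scale1r -scalerA -vE subrr.
have xc : (psi u' * x + d * b) * c' = 1.
  rewrite mulrDl -!mulrA -u0E -dE -ux rmorphB rmorph1 rmorphM /=.
  by rewrite addrC subrK.
by exists (psi u' * x + d * b); split=> //; exact: (@sl_left_inverse _ s).
Qed.

Lemma annihilator_irreducible_generator v : v <> 0 -> exists u0,
  irreducible_elt (psi u0) /\
  forall u, u *: v = 0 <-> exists b, psi u = b * psi u0.
Proof.
move=> v0; have [u0 [u00 annP]] := annihilator_principal v0.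
by exists u0; split=> //; exact: annihilator_irreducible v0 u00 annP.
Qed.
End TorsionFree.

(** The isomorphism sends [u *: v] to the class of [psi u]; the hypothesis on annihilators makes it
    well defined and injective. *)
Lemma cyclic_image_quot_iso (A B : pzRingType) (psi : {rmorphism A -> B})
    (V : lmodType A) (v : V) (alpha : B) :
  simple_module V -> v <> 0 ->
  (forall u, u *: v = 0 <-> exists b, psi u = b * alpha) ->
  lmod_isomorphic V (image_quot psi alpha).
Proof.
move=> simV v0 annP.
have gen := simple_module_generated simV v0.
pose cls u : restr psi (lquot (left_ideal alpha)) :=
  lproj (left_ideal alpha) (psi u).
have clsP u : cls u \in @image_quot_pred _ _ psi alpha.
  by apply/image_quotP; exists u, 0; rewrite mul0r addr0.
have cls_eq u u' : cls u = cls u' <-> u *: v = u' *: v.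
  rewrite /cls lproj_eq; split=> [/left_idealP[d dE]|uv].
    by apply/subr0_eq; rewrite -scalerBl; apply/annP; exists d; rewrite rmorphB.
  have /annP[d dE] : (u - u') *: v = 0 by rewrite scalerBl uv subrr.
  by apply/left_idealP; exists d; rewrite -dE rmorphB.
(* A choice of [u] with [w = u *: v]; by [cls_eq] the class of [psi u] does not depend on it. *)
pose coef w := projT1 (cid (gen w)).
have coefE w : w = coef w *: v by rewrite /coef; case: cid.
pose h w : image_quot psi alpha := exist _ (cls (coef w)) (clsP (coef w)).
have h_linear : linear h.
  move=> a w w'; apply: val_inj; rewrite /=.
  transitivity (cls (a * coef w + coef w')).
    by apply/cls_eq; rewrite -coefE scalerDl -scalerA -!coefE.
  rewrite /cls rmorphD rmorphM raddfD; congr (_ + _).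
  by rewrite -[RHS]linearZ.
pose hL : {linear V -> image_quot psi alpha} :=
  HB.pack h (GRing.isLinear.Build A V (image_quot psi alpha) *:%R h h_linear).
have lift (z : image_quot psi alpha) : exists u, val z = cls u.
  case: z => z /= /image_quotP[u [b ->]]; exists u.
  by apply/lproj_eq/left_idealP; exists b; rewrite addrAC subrr add0r.
exists hL, (fun z => projT1 (cid (lift z)) *: v) => [w|z] /=.
  by rewrite [RHS]coefE; apply/cls_eq; case: cid.
apply: val_inj; case: cid => u /= ->; apply/cls_eq.
by rewrite -coefE.
Qed.

(** * The algebra U_c *)

Section Uc.
Variables (k : fieldType) (q : k) (q0 : q != 0) (c : k).
Local Notation U := (uc q0 c).
Local Notation nu0 := (expf_neq0 2 q0).
Local Notation K := (uc_K q0 c).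
Local Notation psi := (phiB q0 c).

Lemma phiB_alg (a : k) :
  psi a%:A = sl_term (dilation_aut nu0) (FracField.tofrac a%:P) 0.
Proof.
rewrite /phiB /= rmorph_alg rmorph_alg.
by rewrite -[LHS]/(lt_const nu0 a * 1) mulr1.
Qed.

Lemma phiB_K : psi K = sl_term (dilation_aut nu0) (FracField.tofrac 'X) 0.
Proof.
rewrite /phiB /=; have [_ _ -> _] := phi_gen q0 c.
by have [-> _ _ _] := qt_iota_gen nu0.
Qed.

Lemma phiB_F : psi (uc_F q0 c) = sl_term (dilation_aut nu0) 1 1.
Proof.
rewrite /phiB /=; have [_ -> _ _] := phi_gen q0 c.
by have [_ _ -> _] := qt_iota_gen nu0.
Qed.

Hypothesis q21 : q ^+ 2 != 1.

Lemma torsionfree_uc_module (V : lmodType U) : simple_module V ->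
  (forall (f : {poly k}) (v : V), f != 0 -> horner_alg K f *: v = 0 -> v = 0) ->
  exists alpha : qtorus nu0,
    [/\ R_c c alpha, irreducible_elt (qt_iota nu0 alpha) &
        lmod_isomorphic V (RcB_module c alpha)].
Proof.
move=> simV tfV; have [[v v0] _] := simV.
have fracP (z : {fraction {poly k}}) :
    exists a b : {poly k}, b != 0 /\ z = FracField.tofrac a / FracField.tofrac b.
  by exists \n_(repr z), \d_(repr z); rewrite denom_ratioP -fracE.
have frac_inj : injective (@FracField.tofrac {poly k}).
  by move=> f g /eqP; rewrite tofrac_eq => /eqP.
have [u0 [irr annP]] := annihilator_irreducible_generator
  (s := dilation_aut nu0) (psi := psi) (@uc_relations k q q0 c)
  (@uc_casimir k q q0 c) q0 (@uc_ind k q q0 c) frac_inj fracP (dilation_tofrac nu0)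
  phiB_alg phiB_K phiB_F q21 simV tfV v0.
exists (phi q0 c u0); split.
- by exists u0.
- exact irr.
- exact: cyclic_image_quot_iso simV v0 annP.
Qed.
End Uc.

(** The cases ask whether [F] or [E] kills any weight vector of [V], not just [v], so that in the
    last one the chain through [v] never vanishes. *)
Lemma weight_module (k : fieldType) (q : k) (q0 : q != 0)
    (q_nonroot : forall n : nat, (0 < n)%N -> q ^+ n != 1) (c : k)
    (V : lmodType (uc q0 c)) (v : V) (lam : k) :
  simple_module V -> v <> 0 -> uc_K q0 c *: v = lam%:A *: v ->
  lowest_weight_module V \/ highest_weight_module V \/ intermediate_series V.
Proof.
move=> simV v0 Kv; have relU := @uc_relations k q q0 c.
have [lowest|/forallNP noF] := EM (exists w : V, exists mu : k,
    [/\ w <> 0, uc_K q0 c *: w = mu%:A *: w & uc_F q0 c *: w = 0]).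
  left; have [w [mu [w0 Kw Fw]]] := lowest; exists w, mu; split=> //.
    exact: simple_module_generated simV w0.
  exact: weight_neq0 relU _ _ _ w0 Kw.
have [highest|/forallNP noE] := EM (exists w : V, exists mu : k,
    [/\ w <> 0, uc_K q0 c *: w = mu%:A *: w & uc_E q0 c *: w = 0]).
  right; left; have [w [mu [w0 Kw Ew]]] := highest; exists w, mu; split=> //.
    exact: simple_module_generated simV w0.
  exact: weight_neq0 relU _ _ _ w0 Kw.
have E_inj (w : V) mu :
    w <> 0 -> uc_K q0 c *: w = mu%:A *: w -> uc_E q0 c *: w <> 0.
  by move=> w0 Kw Ew; apply: (noE w); exists mu.
have F_inj (w : V) mu :
    w <> 0 -> uc_K q0 c *: w = mu%:A *: w -> uc_F q0 c *: w <> 0.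
  by move=> w0 Kw Fw; apply: (noF w); exists mu.
have casU := @uc_casimir k q q0 c.
right; right; split=> //.
exists (weight_chain (uc_E q0 c) (uc_F q0 c) v), lam; split.
- exact: (weight_chain_basis relU casU q0 q_nonroot v0 Kv E_inj F_inj
            (@uc_ind k q q0 c) simV).
- exact: weight_neq0 relU _ _ _ v0 Kv.
move=> i; split.
- exact: (weight_chainP relU q0 v0 Kv E_inj F_inj i).2.
- exact: (weight_chainE relU casU q0 v0 Kv E_inj F_inj i).
- exact: (weight_chainF relU casU q0 v0 Kv E_inj F_inj i).
Qed.

Theorem theorem4p3 (R : realType) (q : R[i]) (q0 : q != 0)
    (q_not_root_of_unity : forall n : nat, (0 < n)%N -> q ^+ n != 1)
    (c : R[i]) (V : lmodType (uc q0 c)) (V_simple : simple_module V) :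
  lowest_weight_module V \/
  highest_weight_module V \/
  intermediate_series V \/
  (exists alpha : qtorus (expf_neq0 2 q0),
     [/\ R_c c alpha,
         irreducible_elt (qt_iota (expf_neq0 2 q0) alpha) &
         lmod_isomorphic V (RcB_module c alpha)]).
Proof.
have [[f [v [f0 v0 fv0]]]|tfV] := EM (exists f (v : V),
    [/\ f != 0, v <> 0 & horner_alg (uc_K q0 c) f *: v = 0]).
  have [w [lam [w0 Kw]]] := torsion_eigenvector f0 v0 fv0.
  by have [|[|]] := weight_module q_not_root_of_unity V_simple w0 Kw; tauto.
(* The condition [q ^+ 2 != 1] is the case [n = 2]. *)
do 3!right; apply: torsionfree_uc_module => //; first exact: q_not_root_of_unity.
move=> f v f0 fv0; apply: contrapT => v0.
by apply: tfV; exists f, v.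
Qed.
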